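(* Let $D$ be an integral domain and let $*$ be a star operation of finite type on $D$. The following statements are equivalent: (1) $D$ is a $*$-$\mathrm{h}$-local P$*$MD. (2) Every nonzero $*$-ideal of $D$ can be written as a finite $*$-product of $*$-comaximal valuation ideals of $D$. (2') Every nonzero $*$-finite $*$-ideal of $D$ can be written as a finite $*$-product of $*$-comaximal valuation ideals of $D$. (3) Every nonzero principal ideal of $D$ can be written as a finite $*$-product of $*$-comaximal valuation ideals of $D$. (4) $D$ is $*$-treed and $D$ is a $*$-VIFD. (5) $D$ is $*$-treed and every nonzero prime ideal of $D$ contains a $*$-invertible valuation ideal of $D$. (6) $D$ is $*$-treed and every nonzero $*$-ideal of $D$ is a finite $*$-product of valuation ideals of $D$.
   Context: Let $D$ be an integral domain with quotient field $K$. An overring of $D$ is a subring of $K$ containing $D$. $F(D)$ (resp. $f(D)$) is the set of nonzero fractional (resp. nonzero finitely generated fractional) ideals of $D$; for $A\in F(D)$, $A^{-1}=\{x\in K\mid xA\subseteq D\}$. A star operation on $D$ is a map $*:F(D)\to F(D)$, $A\mapsto A_*$, such that for all $A,B\in F(D)$ and nonzero $c\in K$: $A\subseteq A_*=(A_* )_*$; $A\subseteq B$ implies $A_*\subseteq B_*$; $(cA)_*=cA_*$; $D_*=D$. It is of finite type if $A_*=\bigcup_{C\in f(D),\,C\subseteq A}C_*$ for all $A\in F(D)$. A $*$-ideal is an $I\in F(D)$ with $I\subseteq D$ and $I_*=I$; it is $*$-finite if $I=J_*$ for some $J\in f(D)$. A maximal $*$-ideal is a $*$-ideal maximal among the proper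 $*$-ideals. $I\in F(D)$ is $*$-invertible if $(II^{-1})_*=D$. A finite $*$-product of ideals $I_1,\dots,I_n$ is $(\prod_{i=1}^n I_i)_*$. Ideals $I_1,\dots,I_n$ are $*$-comaximal if $(I_i+I_j)_*=D$ for all distinct $i,j$. An ideal $I$ of $D$ is a valuation ideal if there is a valuation overring $V$ of $D$ with $IV\cap D=I$ ($D$ itself is allowed). $D$ is a $*$-VIFD ($*$-valuation ideal factorization domain) if each nonzero principal ideal $I$ of $D$ can be written as $I=(\prod_{i=1}^n I_i)_*$ with $n\in\mathbb{N}$ and valuation ideals $I_i$ of $D$. $D$ is $*$-$\mathrm{h}$-local if each nonzero nonunit of $D$ is contained in only finitely many maximal $*$-ideals and every nonzero prime $*$-ideal of $D$ is contained in a unique maximal $*$-ideal. For $*$ of finite type, $D$ is a P$*$MD (Prüfer $*$-multiplication domain) if every nonzero finitely generated ideal of $D$ is $*$-invertible. $D$ is $*$-treed if the set of prime $*$-ideals of $D$ is treed under inclusion; equivalently, ${\rm Spec}(D_M)$ is linearly ordered under inclusion for every maximal $*$-ideal $M$ of $D$. *)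

(* Defs.v *)
From HB Require Import structures.
From mathcomp Require Import all_boot all_order all_algebra.
From mathcomp Require Import boolp classical_sets functions cardinality.

Set Implicit Arguments.
Unset Strict Implicit.
Unset Printing Implicit Defensive.

Import GRing.Theory.
Local Open Scope classical_set_scope.
Local Open Scope ring_scope.

(* The quotient field K of D is {fraction D}, and D is identified with its
   image dom D in K: ideals, fractional ideals and overrings of D are all
   subsets of K. *)
Definition dom (D : idomainType) : set {fraction D} := range (@tofrac D).
Arguments dom D : clear implicits.

Section Ideals.
Variable D : idomainType.
Local Notation K := {fraction D}.
Local Notation DK := (dom D).
Implicit Types (A B C I J M P V : set K) (x y c : K).

Definition submodule A : Prop :=
  [/\ A 0, (forall x y, A x -> A y -> A (x + y))
    & forall d x, DK d -> A x -> A (d * x)].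

(* F(D): the zero ideal is excluded. *)
Definition fractional_ideal A : Prop :=
  [/\ submodule A, (exists2 x, A x & x != 0)
    & exists2 d, DK d /\ d != 0 & forall x, A x -> DK (d * x)].

Definition generated_by n (g : 'I_n -> K) : set K :=
  [set x | exists2 d : 'I_n -> K,
             (forall i, DK (d i)) & x = \sum_(i < n) d i * g i].

(* f(D) *)
Definition fg_fractional_ideal A : Prop :=
  fractional_ideal A /\ exists n (g : 'I_n -> K), A = generated_by g.

Definition ideal I : Prop := submodule I /\ I `<=` DK.

Definition nonzero_ideal I : Prop := ideal I /\ exists2 x, I x & x != 0.

Definition principal x : set K := [set d * x | d in DK].

Definition prime_ideal P : Prop :=
  [/\ ideal P, P <> DK
    & forall x y, DK x -> DK y -> P (x * y) -> P x \/ P y].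

Definition ideal_scale c A : set K := [set c * x | x in A].

Definition ideal_add A B : set K := [set x + y | x in A & y in B].

(* Finite sums of products; for an overring V, ideal_mul I V is IV. *)
Definition ideal_mul A B : set K :=
  [set x | exists n (a b : 'I_n -> K),
     [/\ forall i, A (a i), forall i, B (b i) & x = \sum_(i < n) a i * b i]].

Definition ideal_prod n (I : 'I_n -> set K) : set K :=
  \big[ideal_mul/DK]_(i < n) I i.

Definition ideal_inv A : set K := [set x | ideal_scale x A `<=` DK].

Definition overring V : Prop :=
  [/\ DK `<=` V, (forall x y, V x -> V y -> V (x - y))
    & forall x y, V x -> V y -> V (x * y)].

Definition valuation_overring V : Prop :=
  overring V /\ forall x, x != 0 -> V x \/ V x^-1.

Definition valuation_ideal I : Prop :=
  ideal I /\ exists2 V, valuation_overring V & ideal_mul I V `&` DK = I.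

(* A star operation is encoded as a map on all subsets of K of which only the
   values on F(D) matter; every notion below evaluates it on F(D) only. *)
Record star_operation (star : set K -> set K) : Prop := StarOperation {
  star_fractional : forall A, fractional_ideal A -> fractional_ideal (star A);
  star_ext : forall A, fractional_ideal A -> A `<=` star A;
  star_idem : forall A, fractional_ideal A -> star (star A) = star A;
  star_mono : forall A B, fractional_ideal A -> fractional_ideal B ->
    A `<=` B -> star A `<=` star B;
  star_scale : forall A c, fractional_ideal A -> c != 0 ->
    star (ideal_scale c A) = ideal_scale c (star A);
  star_dom : star DK = DK
}.

Variable star : set K -> set K.

Definition finite_type : Prop :=
  forall A, fractional_ideal A ->
    star A = \bigcup_(C in [set C | fg_fractional_ideal C /\ C `<=` A]) star C.

Definition star_ideal I : Prop :=
  [/\ fractional_ideal I, I `<=` DK & star I = I].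

Definition star_finite I : Prop :=
  exists2 J, fg_fractional_ideal J & I = star J.

Definition prime_star_ideal P : Prop := prime_ideal P /\ star_ideal P.

Definition maximal_star_ideal M : Prop :=
  [/\ star_ideal M, M <> DK
    & forall J, star_ideal J -> J <> DK -> M `<=` J -> J = M].

Definition star_invertible I : Prop :=
  fractional_ideal I /\ star (ideal_mul I (ideal_inv I)) = DK.

Definition star_comaximal n (I : 'I_n -> set K) : Prop :=
  forall i j, i != j -> star (ideal_add (I i) (I j)) = DK.

(* The factors are nonzero, so that their product lies in F(D). *)
Definition star_product_of_valuation_ideals J : Prop :=
  exists n (I : 'I_n -> set K),
    [/\ (0 < n)%N, forall i, nonzero_ideal (I i),
        forall i, valuation_ideal (I i) & J = star (ideal_prod I)].

Definition star_product_of_comaximal_valuation_ideals J : Prop :=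
  exists n (I : 'I_n -> set K),
    [/\ (0 < n)%N, forall i, nonzero_ideal (I i),
        forall i, valuation_ideal (I i), star_comaximal I
      & J = star (ideal_prod I)].

Definition star_VIFD : Prop :=
  forall a : D, a != 0 ->
    star_product_of_valuation_ideals (principal (tofrac a)).

Definition star_h_local : Prop :=
  (forall a : D, a != 0 -> a \isn't a GRing.unit ->
     finite_set [set M | maximal_star_ideal M /\ M (tofrac a)])
  /\ (forall P, prime_star_ideal P ->
        exists! M, maximal_star_ideal M /\ P `<=` M).

Definition PstarMD : Prop :=
  forall J, fg_fractional_ideal J -> J `<=` DK -> star_invertible J.

(* A set of primes is treed if the members below any given member form a
   chain. *)
Definition star_treed : Prop :=
  forall P Q1 Q2, prime_star_ideal P -> prime_star_ideal Q1 ->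
    prime_star_ideal Q2 -> Q1 `<=` P -> Q2 `<=` P ->
    Q1 `<=` Q2 \/ Q2 `<=` Q1.

End Ideals.

(* Main.v *)
Require Import Defs.
From HB Require Import structures.
From mathcomp Require Import all_boot all_order all_algebra.
From mathcomp Require Import boolp classical_sets functions cardinality.
From mathcomp Require Import generic_quotient ring.

Set Implicit Arguments.
Unset Strict Implicit.
Unset Printing Implicit Defensive.

Import GRing.Theory.
Local Open Scope classical_set_scope.
Local Open Scope ring_scope.

(** Write D_M for the localization of D at a prime star ideal M. The theorem
    reduces everything to the statement that every D_M is a valuation ring.

    Why factorizations see D_M. For an integral ideal A, the closure of A
    contains every x in D lying in all A D_M with M maximal
    ([star_local]): otherwise the conductor of x into A would sit in some M.
    When D_M is a valuation ring, conversely, the closure of A lies in A D_M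
    ([star_sub_localize]), because finitely generated ideals become principal
    there. The Pruefer condition says exactly that all D_M with M maximal are
    valuation rings ([PstarMD_valuation], [valuation_PstarMD]).

    From h-locality to factorizations. A proper star ideal I lies in finitely
    many maximal star ideals M, and I is the closed product of its components
    (I D_M) meet D, which are valuation ideals since D_M is a valuation
    ring. A component of I at M lies in no other maximal star ideal N: if it
    did, I would avoid all products s t with s outside M and t outside N, so a
    prime star ideal over I would lie in both M and N.

    From comaximal factorizations to treedness. Let (ab) be such a product and
    P a prime star ideal. At most one factor I lies in P, so ab D_P = I D_P.
    If I comes from a valuation overring V and a/b is in V, then
    a^2 = ab (a/b) lies in I D_P, hence b divides a in D_P. So D_P is a
    valuation ring and its primes form a chain. Moreover each factor of a
    principal closed product is invertible
    ([star_product_factor_invertible]), and a prime containing the product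
    contains a factor.

    From treedness and invertible valuation ideals back to h-locality. An
    invertible valuation ideal I generates a principal ideal c D_M with
    c V meet D_M = c D_M; call such c a valuation element. Treedness makes
    every two elements of D_M comparable up to powers ([treed_powers]). If b
    divides a power of a valuation element c, then b and c are comparable for
    divisibility: if c does not divide b, then c/b is in V, so
    c^(k+1)/b in D_M forces c^k/b in D_M, down to c/b
    ([valuation_element_root]). As every prime star ideal contains
    valuation elements, all of D_M turns out to be totally ordered by
    divisibility ([valuation_localize]). Once the D_M are valuation rings, an
    invertible valuation ideal lies in at most one maximal star ideal
    ([invertible_valuation_ideal_primes]), which gives uniqueness in the
    definition of h-locality. For finiteness, a nonzero element lying in
    infinitely many maximal star ideals would lie in a prime star ideal
    containing no finitely generated ideal that lies in only finitely many of
    them, and invertible valuation ideals contradict this.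

    All the primes needed come from a single application of Zorn's lemma,
    [prime_star_ideal_avoiding]. *)

(** * Ideals of a domain inside its quotient field *)

Section Ideals.
Variable D : idomainType.
Local Notation K := {fraction D}.
Local Notation DK := (dom D).
Implicit Types (A B C I J M P V S : set K) (x y z a b c d s t : K).

Lemma dom0 : DK 0. Proof. by exists 0; rewrite ?rmorph0. Qed.
Lemma dom1 : DK 1. Proof. by exists 1; rewrite ?rmorph1. Qed.

Lemma domD x y : DK x -> DK y -> DK (x + y).
Proof. by move=> [a _ <-] [b _ <-]; exists (a + b); rewrite ?rmorphD. Qed.

Lemma domB x y : DK x -> DK y -> DK (x - y).
Proof. by move=> [a _ <-] [b _ <-]; exists (a - b); rewrite ?rmorphB. Qed.

Lemma domM x y : DK x -> DK y -> DK (x * y).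
Proof. by move=> [a _ <-] [b _ <-]; exists (a * b); rewrite ?rmorphM. Qed.

Lemma domX x n : DK x -> DK (x ^+ n).
Proof. by move=> [a _ <-]; exists (a ^+ n); rewrite ?rmorphXn. Qed.

Hint Resolve dom0 dom1 domD domM domX : core.

Lemma submodule_dom : submodule DK. Proof. by split; auto. Qed.

Lemma div_neq0 x y : x != 0 -> y != 0 -> x / y != 0.
Proof. by move=> x0 y0; rewrite mulf_neq0 ?invr_eq0. Qed.

Lemma frac_dom x : exists a b, [/\ DK a, DK b, b != 0 & x = a / b].
Proof.
have [a [b [b0 ->]]] : exists a b : D, b != 0 /\ x = tofrac a / tofrac b.
  elim/quotW: x => r; exists (frac r).1, (frac r).2.
  split; first exact: denom_ratioP.
  unlock FracField.tofrac; rewrite -[X in _ * X]FracField.pi_inv.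
  rewrite -[RHS]FracField.pi_mul /FracField.invf /FracField.mulf.
  rewrite !numden_Ratio ?oner_neq0 ?denom_ratioP // mulr1 mul1r.
  by rewrite Ratio_numden.
exists (tofrac a), (tofrac b); split=> //; [by exists a|by exists b|].
by rewrite tofrac_eq0.
Qed.


Lemma dom_prod n (f : 'I_n -> K) (r : pred 'I_n) :
  (forall i, DK (f i)) -> DK (\prod_(i < n | r i) f i).
Proof. by move=> fD; apply: (big_ind (fun x => DK x)); auto. Qed.

Lemma submodule_sum A n (f : 'I_n -> K) : submodule A ->
  (forall i, A (f i)) -> A (\sum_(i < n) f i).
Proof. by case=> A0 AD _ fA; apply: (big_ind (fun x => A x)). Qed.

Lemma nonzero_ideal_fractional A : nonzero_ideal A -> fractional_ideal A.
Proof.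
move=> [[Asub AD] Ane]; split=> //; exists 1; first by rewrite oner_eq0.
by move=> x /AD; rewrite mul1r.
Qed.

Lemma fractional_nonzero_ideal A :
  fractional_ideal A -> A `<=` DK -> nonzero_ideal A.
Proof. by case. Qed.

Lemma nonzero_ideal_dom : nonzero_ideal DK.
Proof.
by split; [split=> //; exact: submodule_dom|exists 1; rewrite ?oner_eq0].
Qed.

Lemma mem_generated n (g : 'I_n -> K) i : generated_by g (g i).
Proof.
exists (fun j => (j == i)%:R) => [j|]; first by case: (j == i).
rewrite (bigD1 i) //= eqxx mul1r big1 ?addr0 // => j /negPf ->.
by rewrite mul0r.
Qed.

Lemma generated_sub n (g : 'I_n -> K) A :
  submodule A -> (forall i, A (g i)) -> generated_by g `<=` A.
Proof.
move=> sA gA _ [d dD ->]; apply: submodule_sum => // i.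
by case: sA => _ _; apply.
Qed.

Lemma submodule_generated n (g : 'I_n -> K) : submodule (generated_by g).
Proof.
split=> [|_ _ [d dD ->] [e eD ->]|c _ cD [d dD ->]].
- by exists (fun=> 0) => //; rewrite big1 // => i _; rewrite mul0r.
- exists (fun i => d i + e i) => [i|]; first exact: domD.
  by rewrite -big_split; apply: eq_bigr => i _; rewrite mulrDl.
- exists (fun i => c * d i) => [i|]; first exact: domM.
  by rewrite mulr_sumr; apply: eq_bigr => i _; rewrite mulrA.
Qed.

Lemma generated_directed A n (g : 'I_n -> K) m (h : 'I_m -> K) :
    (forall i, A (g i)) -> (forall i, A (h i)) ->
  exists k (u : 'I_k -> K), [/\ forall i, A (u i),
    generated_by g `<=` generated_by u & generated_by h `<=` generated_by u].
Proof.
move=> Ag Ah; pose u i := match fintype.split i with inl j => g j | inr j => h j end.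
exists (n + m)%N, u; split=> [i||].
- by rewrite /u; case: fintype.split.
- apply: generated_sub (submodule_generated u) _ => i.
  have -> : g i = u (unsplit (inl i)) by rewrite /u unsplitK.
  exact: mem_generated.
- apply: generated_sub (submodule_generated u) _ => i.
  have -> : h i = u (unsplit (inr i)) by rewrite /u unsplitK.
  exact: mem_generated.
Qed.

Lemma principal_generated x : principal x = generated_by (fun _ : 'I_1 => x).
Proof.
apply/seteqP; split=> [_ [d dD <-]|_ [d dD ->]].
  by exists (fun=> d) => //; rewrite big_ord1.
by rewrite big_ord1; exists (d ord0).
Qed.

Lemma submodule_principal x : submodule (principal x).
Proof. by rewrite principal_generated; exact: submodule_generated. Qed.

Lemma mem_principal x : principal x x.
Proof. by exists 1; rewrite ?mul1r. Qed.

Lemma principal_sub A x : submodule A -> A x -> principal x `<=` A.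
Proof. by case=> _ _ AM Ax _ [d dD <-]; exact: AM. Qed.

Lemma nonzero_ideal_principal x : DK x -> x != 0 -> nonzero_ideal (principal x).
Proof.
move=> xD x0; split; last by exists x => //; exact: mem_principal.
by split; [exact: submodule_principal | exact: principal_sub submodule_dom _].
Qed.

Lemma scale_dom x : ideal_scale x DK = principal x.
Proof. by apply/seteqP; split=> _ [d dD <-]; exists d; rewrite // mulrC. Qed.

Lemma mem_ideal_mul A B x y : A x -> B y -> ideal_mul A B (x * y).
Proof.
by move=> Ax By; exists 1%N, (fun=> x), (fun=> y); split; rewrite ?big_ord1.
Qed.

Lemma ideal_mul_sub A B S :
    S 0 -> (forall x y, S x -> S y -> S (x + y)) ->
    (forall x y, A x -> B y -> S (x * y)) ->
  ideal_mul A B `<=` S.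
Proof.
move=> S0 SD ABS _ [n [a [b [aA bB ->]]]].
by apply: (big_ind (fun x => S x)) => // i _; exact: ABS.
Qed.

Lemma submodule_ideal_mul A B :
  (forall d x, DK d -> A x -> A (d * x)) -> submodule (ideal_mul A B).
Proof.
move=> AM; split.
- exists 0%N, (fun=> 0), (fun=> 0); split; [by case|by case|].
  by rewrite big_ord0.
- move=> _ _ [n [a [b [aA bB ->]]]] [m [a' [b' [aA' bB' ->]]]].
  exists (n + m)%N, (fun i => match fintype.split i with inl j => a j | inr j => a' j end),
    (fun i => match fintype.split i with inl j => b j | inr j => b' j end).
  split=> [i|i|]; [by case: fintype.split|by case: fintype.split|].
  rewrite big_split_ord /=; congr (_ + _); apply: eq_bigr => i _.
    by rewrite -[lshift m i]/(unsplit (inl i)) unsplitK.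
  by rewrite -[rshift n i]/(unsplit (inr i)) unsplitK.
- move=> d _ dD [n [a [b [aA bB ->]]]].
  exists n, (fun i => d * a i), b; split=> // [i|]; first exact: AM.
  by rewrite mulr_sumr; apply: eq_bigr => i _; rewrite mulrA.
Qed.

Lemma nonzero_ideal_mul A B :
  nonzero_ideal A -> nonzero_ideal B -> nonzero_ideal (ideal_mul A B).
Proof.
move=> [[[A0 AD AM] Asub] [x Ax x0]] [[_ Bsub] [y By y0]]; split.
  split; first exact: submodule_ideal_mul.
  by apply: ideal_mul_sub; auto => a b /Asub aD /Bsub; auto.
by exists (x * y); [exact: mem_ideal_mul | rewrite mulf_neq0].
Qed.

(** The pairwise products of generators generate, by bilinearity. *)
Lemma ideal_mul_generated n (g : 'I_n -> K) m (h : 'I_m -> K) :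
  exists k (u : 'I_k -> K),
    ideal_mul (generated_by g) (generated_by h) = generated_by u.
Proof.
pose u (k : 'I_#|{: 'I_n * 'I_m}|) := g (enum_val k).1 * h (enum_val k).2.
exists _, u; have [u0 uD uM] := submodule_generated u.
apply/seteqP; split.
  apply: ideal_mul_sub => // x y gx hy.
  apply: (@generated_sub _ g [set x | generated_by u (x * y)]) gx => [|i] /=.
    split=> /= [|a b ua ub|d a dD ua]; first by rewrite mul0r.
      by rewrite mulrDl; exact: uD.
    by rewrite -mulrA; exact: uM.
  apply: (@generated_sub _ h [set y | generated_by u (g i * y)]) hy => [|j] /=.
    split=> /= [|a b ua ub|d a dD ua]; first by rewrite mulr0.
      by rewrite mulrDr; exact: uD.
    by rewrite mulrCA; exact: uM.
  by have := mem_generated u (enum_rank (i, j)); rewrite /u enum_rankK.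
apply: generated_sub => [|k]; last by apply: mem_ideal_mul; exact: mem_generated.
by apply: submodule_ideal_mul; have [] := submodule_generated g.
Qed.

Lemma ideal_mul_dom : ideal_mul DK DK = DK.
Proof.
apply/seteqP; split; first by apply: ideal_mul_sub; auto.
by move=> x xD; rewrite -[x]mulr1; exact: mem_ideal_mul.
Qed.

Lemma nonzero_ideal_add A B :
  nonzero_ideal A -> nonzero_ideal B -> nonzero_ideal (ideal_add A B).
Proof.
move=> [[[A0 AD AM] Asub] [x Ax x0]] [[[B0 BD BM] Bsub] _]; split; last first.
  by exists x => //; exists x => //; exists 0; rewrite ?addr0.
split; last by move=> _ [a /Asub aD [b /Bsub bD <-]]; auto.
split.
- by exists 0 => //; exists 0; rewrite ?addr0.
- move=> _ _ [a Aa [b Bb <-]] [a' Aa' [b' Bb' <-]].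
  exists (a + a'); first exact: AD.
  by exists (b + b'); [exact: BD | rewrite addrACA].
- move=> d _ dD [a Aa [b Bb <-]]; exists (d * a); first exact: AM.
  by exists (d * b); [exact: BM | rewrite mulrDr].
Qed.

Lemma nonzero_ideal_scale A x :
  DK x -> x != 0 -> nonzero_ideal A -> nonzero_ideal (ideal_scale x A).
Proof.
move=> xD x0 [[[A0 AD AM] Asub] [y Ay y0]]; split; last first.
  by exists (x * y); [exists y | rewrite mulf_neq0].
split; last by move=> _ [a /Asub aD <-]; auto.
split.
- by exists 0; rewrite ?mulr0.
- by move=> _ _ [a Aa <-] [b Ab <-]; exists (a + b); rewrite ?mulrDr; auto.
- by move=> d _ dD [a Aa <-]; exists (d * a); [exact: AM | rewrite mulrCA].
Qed.

Lemma nonzero_ideal_mul_inv A :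
  nonzero_ideal A -> nonzero_ideal (ideal_mul A (ideal_inv A)).
Proof.
move=> [[[A0 AD AM] Asub] [x Ax x0]]; split; last first.
  exists x => //; rewrite -[x]mulr1; apply: mem_ideal_mul => //.
  by move=> _ [a /Asub aD <-]; rewrite mul1r.
split; first exact: submodule_ideal_mul.
by apply: ideal_mul_sub; auto => a b Aa; apply; exists a; rewrite // mulrC.
Qed.

Lemma mem_ideal_prod n (I : 'I_n -> set K) (t : 'I_n -> K) :
  (forall i, I i (t i)) -> ideal_prod I (\prod_(i < n) t i).
Proof.
elim: n I t => [|n IH] I t It; rewrite /ideal_prod.
  by rewrite !big_ord0.
by rewrite !big_ord_recl; apply: mem_ideal_mul => //; exact: IH.
Qed.

(** Iterated sums of products collapse, by multilinearity, to sums of pure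
    products t_1 ... t_n; checking these is therefore enough. *)
Lemma ideal_prod_sub n (I : 'I_n -> set K) S : submodule S ->
  (forall t : 'I_n -> K, (forall i, I i (t i)) -> S (\prod_(i < n) t i)) ->
  ideal_prod I `<=` S.
Proof.
elim: n I S => [|n IH] I S sS HS; rewrite /ideal_prod.
  rewrite big_ord0 => d dD; case: sS => _ _ SM; rewrite -[d]mulr1.
  apply: SM => //; have := HS (fun=> 0); rewrite big_ord0; apply; by case.
case: (sS) => S0 SD SM.
rewrite big_ord_recl; apply: ideal_mul_sub => // a y Ia.
apply: (IH _ [set y | S (a * y)]).
  split=> [|x z /= Sx Sz|d x dD /= Sx] /=; first by rewrite mulr0.
    by rewrite mulrDr; exact: SD.
  by rewrite mulrCA; exact: SM.
move=> t It /=.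
pose u i := if unlift ord0 i is Some j then t j else a.
have := HS u; rewrite big_ord_recl {2}/u unlift_none.
have -> : \prod_(i < n) u (lift ord0 i) = \prod_(i < n) t i.
  by apply: eq_bigr => i _; rewrite /u liftK.
by apply=> i; rewrite /u; case: unliftP => [j ->|->].
Qed.

Lemma nonzero_ideal_prod n (I : 'I_n -> set K) :
  (forall i, nonzero_ideal (I i)) -> nonzero_ideal (ideal_prod I).
Proof.
elim: n I => [|n IH] I HI; rewrite /ideal_prod.
  by rewrite big_ord0; exact: nonzero_ideal_dom.
by rewrite big_ord_recl; apply: nonzero_ideal_mul => //; exact: IH.
Qed.

Lemma ideal_prod_factor n (I : 'I_n -> set K) i :
  (forall i, nonzero_ideal (I i)) -> ideal_prod I `<=` I i.
Proof.
move=> HI; have [[sI _] _] := HI i.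
apply: ideal_prod_sub => // t It; rewrite (bigD1 i) //= mulrC.
case: sI => _ _; apply=> //; apply: dom_prod => j.
by have [[_ ID] _] := HI j; exact: ID.
Qed.

(** * Localization at a prime *)

(** This is A D_M inside the quotient field; for A = D it is the overring D_M
    itself. *)
Definition localize M A : set K :=
  [set x | exists2 s, DK s /\ ~ M s & A (s * x)].

Section Localize.
Variable M : set K.
Hypothesis Mprime : prime_ideal M.

Lemma prime0 : M 0.
Proof. by case: Mprime => [[[]]]. Qed.

Lemma primeM d x : DK d -> M x -> M (d * x).
Proof. by case: Mprime => [[[_ _ MM] _] _ _]; exact: MM. Qed.

Lemma primeMr d x : DK d -> M x -> M (x * d).
Proof. by rewrite mulrC; exact: primeM. Qed.

Lemma prime_dom x : M x -> DK x.
Proof. by case: Mprime => [[_ MD] _ _]; exact: MD. Qed.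

Lemma prime_not1 : ~ M 1.
Proof.
move=> M1; case: Mprime => _ + _; apply; apply/seteqP; split.
  exact: prime_dom.
by move=> x xD; rewrite -[x]mulr1; exact: primeM.
Qed.

Lemma prime_notM s t : DK s -> ~ M s -> DK t -> ~ M t -> ~ M (s * t).
Proof. by case: Mprime => _ _ MP sD Ms tD Mt /MP[]. Qed.

Lemma prime_neq0 s : ~ M s -> s != 0.
Proof. by move=> Ms; apply/eqP => s0; apply: Ms; rewrite s0; exact: prime0. Qed.

Lemma prime_notX s n : DK s -> ~ M s -> ~ M (s ^+ n).
Proof.
move=> sD Ms; elim: n => [|n IH]; first exact: prime_not1.
by rewrite exprS; apply: prime_notM; auto.
Qed.

Lemma prime_X x n : DK x -> M (x ^+ n) -> M x.
Proof. by move=> xD; apply: contraPP => Mx; exact: prime_notX. Qed.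

Lemma prime_not_prod n (f : 'I_n -> K) (r : pred 'I_n) :
  (forall i, r i -> DK (f i) /\ ~ M (f i)) ->
  DK (\prod_(i < n | r i) f i) /\ ~ M (\prod_(i < n | r i) f i).
Proof.
move=> H; apply: (big_ind (fun x => DK x /\ ~ M x)) => //.
  by split=> //; exact: prime_not1.
by move=> x y [xD Mx] [yD My]; split; [exact: domM|exact: prime_notM].
Qed.

Lemma sub_localize A : A `<=` localize M A.
Proof.
by move=> x Ax; exists 1; rewrite ?mul1r //; split=> //; exact: prime_not1.
Qed.

(** Elements outside M become units of D_M. *)
Lemma localize_inv s x A : DK s -> ~ M s -> localize M A (s * x) -> localize M A x.
Proof.
move=> sD Ms [t [tD Mt] Ax]; exists (t * s); last by rewrite -mulrA.
by split; [exact: domM | exact: prime_notM].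
Qed.

Lemma localizeM A x y :
  submodule A -> localize M DK x -> localize M A y -> localize M A (x * y).
Proof.
move=> [_ _ AM] [s [sD Ms] sx] [t [tD Mt] ty]; exists (s * t).
  by split; [exact: domM | exact: prime_notM].
by rewrite mulrACA; exact: AM.
Qed.

Lemma localizeD A x y :
  submodule A -> localize M A x -> localize M A y -> localize M A (x + y).
Proof.
move=> [_ AD AM] [s [sD Ms] sx] [t [tD Mt] ty]; exists (s * t).
  by split; [exact: domM | exact: prime_notM].
rewrite mulrDr; apply: AD; last by rewrite -mulrA; exact: AM.
by rewrite [s * t]mulrC -mulrA; exact: AM.
Qed.

Lemma localize_domM x y :
  localize M DK x -> localize M DK y -> localize M DK (x * y).
Proof. exact: localizeM submodule_dom. Qed.

Lemma localize_dom x : DK x -> localize M DK x.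
Proof. exact: sub_localize. Qed.

Lemma localize_domX x n : localize M DK x -> localize M DK (x ^+ n).
Proof.
move=> Rx; elim: n => [|n IH]; first exact: localize_dom.
by rewrite exprS; exact: localize_domM.
Qed.

Lemma overring_localize : overring (localize M DK).
Proof.
split; [exact: sub_localize| |exact: localize_domM].
move=> x y [s [sD Ms] sx] [t [tD Mt] ty]; exists (s * t).
  by split; [exact: domM | exact: prime_notM].
rewrite mulrBr; apply: domB; last by rewrite -mulrA; auto.
by rewrite [s * t]mulrC -mulrA; auto.
Qed.

End Localize.


(** * Star operations on integral ideals *)

Section Star.
Variable star : set K -> set K.
Hypotheses (star_op : star_operation star) (star_ft : finite_type star).
Local Notation frac_of := nonzero_ideal_fractional.

Lemma sub_star A : nonzero_ideal A -> A `<=` star A.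
Proof. by move=> /frac_of HA; exact: star_ext HA. Qed.

Lemma star_le A B :
  nonzero_ideal A -> nonzero_ideal B -> A `<=` B -> star A `<=` star B.
Proof. by move=> /frac_of HA /frac_of HB; exact: star_mono. Qed.

Lemma star_sub_dom A : nonzero_ideal A -> star A `<=` DK.
Proof.
move=> HA; rewrite -[X in _ `<=` X](star_dom star_op).
by apply: star_le => //; [exact: nonzero_ideal_dom | case: HA => [[]]].
Qed.

Lemma nonzero_ideal_star A : nonzero_ideal A -> nonzero_ideal (star A).
Proof.
move=> HA; apply: fractional_nonzero_ideal; last exact: star_sub_dom.
by apply: star_fractional => //; exact: frac_of.
Qed.

Lemma star_ideal_star A : nonzero_ideal A -> star_ideal star (star A).
Proof.
move=> HA; split; first exact/frac_of/nonzero_ideal_star.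
  exact: star_sub_dom.
by apply: (star_idem star_op); exact: frac_of.
Qed.

Lemma star_ideal_nonzero A : star_ideal star A -> nonzero_ideal A.
Proof. by case=> HA AD _; exact: fractional_nonzero_ideal. Qed.

Lemma star_min A B :
  nonzero_ideal A -> star_ideal star B -> A `<=` B -> star A `<=` B.
Proof.
move=> HA HB AB; have [_ _ <-] := HB.
by apply: star_le => //; exact: star_ideal_nonzero.
Qed.

Lemma star_scale_ideal A x : nonzero_ideal A -> x != 0 ->
  star (ideal_scale x A) = ideal_scale x (star A).
Proof. by move=> /frac_of; exact: star_scale. Qed.

Lemma star_principal x : x != 0 -> star (principal x) = principal x.
Proof.
move=> x0; rewrite -scale_dom star_scale_ideal ?(star_dom star_op) //.
exact: nonzero_ideal_dom.
Qed.

Lemma star_ideal_principal x : DK x -> x != 0 -> star_ideal star (principal x).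
Proof.
move=> xD x0; rewrite -star_principal //.
by apply: star_ideal_star; exact: nonzero_ideal_principal.
Qed.

Lemma ideal_one A : nonzero_ideal A -> A 1 -> A = DK.
Proof.
move=> [[[_ _ AM] AD] _] A1; apply/seteqP; split=> // x xD.
by rewrite -[x]mulr1; exact: AM.
Qed.

(** For b in B the inclusion of b A in A B gives b (star A) inside star (A B).
    Hence x B lies in star (A B) for x in star A, and the same argument applied
    to x B finishes. *)
Lemma star_mul A B x y : nonzero_ideal A -> nonzero_ideal B ->
  star A x -> star B y -> star (ideal_mul A B) (x * y).
Proof.
move=> HA HB Ax By; have HAB := nonzero_ideal_mul HA HB.
have HsAB := nonzero_ideal_star HAB.
have sAB0 : star (ideal_mul A B) 0 by have [[[]]] := HsAB.
have xB b : B b -> star (ideal_mul A B) (b * x).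
  move=> Bb; have [->|b0] := eqVneq b 0; first by rewrite mul0r.
  have bD : DK b by have [[_ BD] _] := HB; exact: BD.
  have : ideal_scale b (star A) (b * x) by exists x.
  rewrite -star_scale_ideal //; apply: star_le => //.
    exact: nonzero_ideal_scale.
  by move=> _ [a Aa <-]; rewrite mulrC; exact: mem_ideal_mul.
have [->|x0] := eqVneq x 0; first by rewrite mul0r.
have xD : DK x by exact: star_sub_dom Ax.
have : ideal_scale x (star B) (x * y) by exists y.
rewrite -star_scale_ideal //; apply: star_min; first exact: nonzero_ideal_scale.
  exact: star_ideal_star.
by move=> _ [b Bb <-]; rewrite mulrC; exact: xB.
Qed.

Lemma star_finitary A x : nonzero_ideal A -> star A x ->
  exists n (g : 'I_n -> K), [/\ forall i, A (g i),
    nonzero_ideal (generated_by g) & star (generated_by g) x].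
Proof.
move=> HA; rewrite star_ft; last exact: frac_of.
move=> [C [[HC [n [g gC]]] CA] Cx]; exists n, g; rewrite -gC; split=> //.
  by move=> i; apply: CA; rewrite gC; exact: mem_generated.
apply: fractional_nonzero_ideal => //; apply: subset_trans CA _.
by case: HA => [[]].
Qed.

Lemma chain_finite (F : set (set K)) X0 n (g : 'I_n -> K) :
    F X0 -> total_on F subset -> (forall i, (\bigcup_(X in F) X) (g i)) ->
  exists X, [/\ F X, X0 `<=` X & forall i, X (g i)].
Proof.
move=> FX0 Ftot; elim: n g => [|n IH] g Hg; first by exists X0; split=> // -[].
have [X [FX X0X HX]] := IH (fun i => g (lift ord0 i)) (fun i => Hg _).
have [Y FY Yg] := Hg ord0; case: (Ftot _ _ FX FY) => XY.
  exists Y; split=> //; first exact: subset_trans XY.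
  by move=> i; case: (unliftP ord0 i) => [j ->|-> //]; exact/XY/HX.
exists X; split=> // i.
by case: (unliftP ord0 i) => [j ->|->]; [exact: HX | exact: XY].
Qed.

(** A prime ideal principle. Finite type makes unions of chains of star ideals
    star ideals, and finite generation of the members of T keeps such a union
    free of members of T, so Zorn's lemma gives a maximal star ideal P over J
    containing no member of T. It is prime: if x y is in P but x and y are not,
    the closures of P + (x) and P + (y) both contain members of T, and so does
    their product, whose closure lies in P.

    Taking a family of ideals for T, and not just a multiplicative set, is what
    the finiteness half of h-locality requires. *)
Lemma prime_star_ideal_avoiding (T : set (set K)) J :
    (forall C, T C -> exists n (g : 'I_n -> K), C = generated_by g) ->
    (exists2 C, T C & C `<=` DK) ->
    (forall B C, T B -> T C -> exists2 E, T E & E `<=` ideal_mul B C) ->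
    star_ideal star J -> (forall C, T C -> ~ C `<=` J) ->
  exists P, [/\ prime_star_ideal star P, J `<=` P, forall C, T C -> ~ C `<=` P
    & forall B, star_ideal star B -> (forall C, T C -> ~ C `<=` B) ->
        P `<=` B -> B = P].
Proof.
move=> Tfg [C0 TC0 C0D] TM HJ JT.
pose good A := [/\ star_ideal star A, J `<=` A & forall C, T C -> ~ C `<=` A].
have goodJ : good J by split.
have JN : nonzero_ideal J := star_ideal_nonzero HJ.
have J0 : J 0 by have [[[]]] := JN.
have [P [PG Pmax]] : exists P, good P /\ forall B, P `<=` B -> good B -> B = P.
  (* Zorn's lemma for unions also asks for the union of the empty chain. *)
  have [F FG Ftot|A [AG Amax]] := @Zorn_bigcup K [set A | A = set0 \/ good A].
    have [F0|/existsNP[X0 /not_implyP[FX0 X0n]]] :=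
        pselect (forall X, F X -> X = set0).
      left; apply/seteqP; split=> // x [X FX Xx].
      by rewrite -(F0 X FX).
    have goodF X : F X -> X0 `<=` X -> good X.
      move=> FX X0X; case: (FG X FX) => // XE.
      by exfalso; apply: X0n; apply/seteqP; rewrite -{1}XE; split.
    have [[sX0 _ _] JX0 _] := goodF X0 FX0 (@subset_refl _ X0).
    set U := \bigcup_(X in F) X.
    have UX n (g : 'I_n -> K) : (forall i, U (g i)) ->
        exists X, [/\ good X, X `<=` U & forall i, X (g i)].
      move=> Ug; have [X [FX X0X Xg]] := chain_finite FX0 Ftot Ug.
      by exists X; split=> //; [exact: goodF | exact: bigcup_sup].
    have UN : nonzero_ideal U.
      split; last first.
        by have [_ [x Jx x0]] := JN; exists x => //; exists X0 => //; exact: JX0.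
      have UX2 x y : U x -> U y -> exists X, [/\ good X, X `<=` U, X x & X y].
        move=> Ux Uy.
        have [|X [GX XU Xg]] := UX 2%N (fun i => if i == ord0 then x else y).
          by move=> i; case: eqP.
        by exists X; split=> //; [exact: (Xg ord0) | exact: (Xg ord_max)].
      split; last first.
        move=> x Ux; have [X [[HX _ _] _ Xx _]] := UX2 _ _ Ux Ux.
        by case: HX => _ XD _; exact: XD.
      split; first by exists X0 => //; exact: JX0.
        move=> x y Ux Uy; have [X [[HX _ _] XU Xx Xy]] := UX2 _ _ Ux Uy.
        by have [[[_ XA _] _] _] := star_ideal_nonzero HX; exact/XU/XA.
      move=> d x dD Ux; have [X [[HX _ _] XU Xx _]] := UX2 _ _ Ux Ux.
      by have [[[_ _ XM] _] _] := star_ideal_nonzero HX; exact/XU/XM.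
    right; split.
    - split; [exact: frac_of|by have [[]] := UN|].
      apply/seteqP; split; last exact: sub_star.
      move=> x /(star_finitary UN)[n [g [Ug gN gx]]].
      have [X [[HX _ _] XU Xg]] := UX n g Ug; apply: XU.
      apply: (star_min gN HX) gx; apply: generated_sub => //.
      by have [[]] := star_ideal_nonzero HX.
    - by apply: subset_trans JX0 _; exact: bigcup_sup.
    - move=> C TC CU; have [n [g gC]] := Tfg C TC.
      have [|X [[HX _ XT] _ Xg]] := UX n g.
        by move=> i; apply: CU; rewrite gC; exact: mem_generated.
      apply: (XT C TC); rewrite gC; apply: generated_sub => //.
      by have [[]] := star_ideal_nonzero HX.
  have GA : good A.
    case: AG => // A0; exfalso; apply: (Amax J); last by right.
    by rewrite A0; split=> // /(_ 0 J0).
  exists A; split=> // B AB GB; apply: contrapT => BA.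
  apply: (Amax B); last by right.
  split=> // BsA; apply: BA; exact/seteqP.
exists P; have [HP JP PT] := PG; split=> //; last first.
  by move=> B HB BT PB; apply: Pmax => //; split=> //; exact: subset_trans PB.
split=> //; have PN := star_ideal_nonzero HP.
have [[sP PD] _] := PN; have [P0 PA PM] := sP.
split=> // [PE|x y xD yD Pxy]; first by apply: (PT _ TC0); rewrite PE.
apply: contrapT => /not_orP[Px Py].
have grow z : DK z -> ~ P z -> exists2 C, T C & C `<=` star (ideal_add P (principal z)).
  move=> zD Pz; apply: contrapT => /forall2NP noC.
  have z0 : z != 0 by apply/eqP => z0; apply: Pz; rewrite z0.
  have aN : nonzero_ideal (ideal_add P (principal z)).
    by apply: nonzero_ideal_add => //; exact: nonzero_ideal_principal.
  have Pa : P `<=` star (ideal_add P (principal z)).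
    apply: subset_trans (sub_star aN) => p Pp; exists p => //.
    by exists 0; rewrite ?addr0 //; exists 0; rewrite ?mul0r.
  apply: Pz; rewrite -(Pmax _ Pa).
    apply: (sub_star aN); exists 0 => //; exists z; rewrite ?add0r //.
    exact: mem_principal.
  split; [exact: star_ideal_star | exact: subset_trans Pa |].
  by move=> C TC; case: (noC C).
have [B TB HB] := grow x xD Px; have [C TC HC] := grow y yD Py.
have [E TE HE] := TM B C TB TC; apply: (PT E TE).
have x0 : x != 0 by apply/eqP => x0; apply: Px; rewrite x0.
have y0 : y != 0 by apply/eqP => y0; apply: Py; rewrite y0.
have xN : nonzero_ideal (ideal_add P (principal x)).
  by apply: nonzero_ideal_add => //; exact: nonzero_ideal_principal.
have yN : nonzero_ideal (ideal_add P (principal y)).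
  by apply: nonzero_ideal_add => //; exact: nonzero_ideal_principal.
apply: subset_trans HE _; apply: ideal_mul_sub => // b c /HB Bb /HC Cc.
have := star_mul xN yN Bb Cc.
apply: star_min => //; first exact: nonzero_ideal_mul.
apply: ideal_mul_sub => // _ _ [p Pp [_ [d dD <-] <-]] [q Pq [_ [e eD <-] <-]].
have pD := PD _ Pp; have -> : (p + d * x) * (q + e * y) =
  (q + e * y) * p + d * x * q + d * e * (x * y) by ring.
by apply: (PA); [apply: (PA); apply: (PM); auto | apply: (PM); auto].
Qed.

Lemma prime_star_ideal_avoiding_elements (T : set K) J :
    T `<=` DK -> T 1 -> (forall x y, T x -> T y -> T (x * y)) ->
    star_ideal star J -> (forall x, T x -> ~ J x) ->
  exists P, [/\ prime_star_ideal star P, J `<=` P & forall x, T x -> ~ P x].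
Proof.
move=> TD T1 TM HJ JT.
have [_ [t _ <-]|||_ [t Tt <-] tJ|P [HP JP PT _]] :=
  prime_star_ideal_avoiding (T := [set principal t | t in T]) _ _ _ HJ.
- by exists 1%N, (fun=> t); exact: principal_generated.
- by exists (principal 1); [exists 1 | exact: principal_sub submodule_dom _].
- move=> _ _ [t Tt <-] [u Tu <-]; exists (principal (t * u)).
    by exists (t * u) => //; exact: TM.
  apply: principal_sub; last by apply: mem_ideal_mul; exact: mem_principal.
  by apply: submodule_ideal_mul; have [_ _] := submodule_principal t.
- by apply: (JT t Tt); apply: tJ; exact: mem_principal.
exists P; split=> // t Tt Pt; apply: (PT (principal t)); first by exists t.
by apply: principal_sub => //; case: HP => [[[]]].
Qed.

Lemma exists_maximal_star_ideal J : star_ideal star J -> J <> DK ->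
  exists2 M, maximal_star_ideal star M /\ prime_star_ideal star M & J `<=` M.
Proof.
move=> HJ JD.
have nD B : star_ideal star B -> B <> DK -> forall C, C = DK -> ~ C `<=` B.
  move=> [_ BD _] nBD C -> DB; apply: nBD; exact/seteqP.
have [_ ->|||_ ->|P [HP JP PT Pmax]] :=
  prime_star_ideal_avoiding (T := [set DK]) _ _ _ HJ.
- exists 1%N, (fun=> 1); rewrite -principal_generated -scale_dom.
  by apply/seteqP; split=> x; [exists x; rewrite ?mul1r|case=> y yD <-; rewrite mul1r].
- by exists DK.
- by move=> _ _ -> ->; exists DK; rewrite ?ideal_mul_dom.
- exact: nD.
exists P => //; split=> //; case: (HP) => [[_ PD _] sP]; split=> // B HB BD.
by apply: Pmax => //; exact: nD.
Qed.

Lemma maximal_star_ideal_prime M :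
  maximal_star_ideal star M -> prime_star_ideal star M.
Proof.
move=> [HM MD Mmax]; have [P [[HP PD _] pP] MP] := exists_maximal_star_ideal HM MD.
by rewrite -(Mmax P HP PD MP).
Qed.

Lemma star_eq_dom A : nonzero_ideal A ->
  (forall M, maximal_star_ideal star M -> ~ A `<=` M) -> star A = DK.
Proof.
move=> HA AM; apply: contrapT => sD.
have [M [mM _] sM] := exists_maximal_star_ideal (star_ideal_star HA) sD.
by apply: (AM M mM); apply: subset_trans sM; exact: sub_star.
Qed.

Lemma prime_star_not_sub A P : nonzero_ideal A -> prime_star_ideal star P ->
  star A = DK -> ~ A `<=` P.
Proof.
move=> HA [HP sP] AD AP; apply: (prime_not1 HP).
by apply: (star_min HA sP AP); rewrite AD.
Qed.

(** The conductor of x into A lies in no maximal star ideal, so its closure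
    contains 1; multiply by x. *)
Lemma star_local A x : nonzero_ideal A -> DK x ->
  (forall M, maximal_star_ideal star M -> localize M A x) -> star A x.
Proof.
move=> HA xD Ax; have HsA := nonzero_ideal_star HA.
have [[[A0 AA AM] AD] [a Aa a0]] := HA.
have [->|x0] := eqVneq x 0; first by have [[[]]] := HsA.
pose C := [set d | DK d /\ A (d * x)].
have HC : nonzero_ideal C.
  split; last first.
    by exists a => //; split; [exact: AD | rewrite mulrC; exact: AM].
  split=> [|d []//]; split=> [|d e [dD Ad] [eD Ae]|d e dD [eD Ae]].
  - by rewrite /C /= mul0r.
  - by split; [exact: domD | rewrite mulrDl; exact: AA].
  - by split; [exact: domM | rewrite -mulrA; exact: AM].
have sC : star C = DK.
  apply: star_eq_dom => // M /Ax [s [sD Ms] As] CM.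
  by apply: Ms; apply: CM.
have : ideal_scale x (star C) x by exists 1; rewrite ?mulr1 // sC.
rewrite -star_scale_ideal //; apply: star_le => //.
  exact: nonzero_ideal_scale.
by move=> _ [d [dD Ad] <-]; rewrite mulrC.
Qed.

(** * Primes with a valuation localization *)

(** Divisibility in a valuation ring is total, so one of the generators divides
    all the others in D_M; a common denominator s clears the quotients. *)
Lemma generated_locally_principal M n (g : 'I_n -> K) :
    prime_ideal M -> valuation_overring (localize M DK) ->
  exists s c, [/\ DK s, ~ M s, generated_by g c
    & forall x, generated_by g x -> principal c (s * x)].
Proof.
move=> pM [_ VM]; have [N0 ND NM] := submodule_generated g.
suff [s [c [sD Ms gc Hg]]] : exists s c, [/\ DK s, ~ M s, generated_by g c
    & forall i, principal c (s * g i)].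
  exists s, c; split=> //; have [P0 PA PM] := submodule_principal c.
  apply: (@generated_sub _ g [set x | principal c (s * x)]) => //.
  split=> /= [|x y|d x dD]; first by rewrite mulr0.
    by rewrite mulrDr; exact: PA.
  by rewrite mulrCA; exact: PM.
elim: n g {N0 ND NM} => [|n IH] g.
  exists 1, 0; split=> //; [exact: prime_not1|by have []:= submodule_generated g|].
  by case.
have [s [c [sD Ms gc Hg]]] := IH (fun i => g (lift ord0 i)).
have {gc} gc : generated_by g c.
  apply: generated_sub gc; first exact: submodule_generated.
  by move=> i; exact: mem_generated.
have [g0|g0] := eqVneq (g ord0) 0.
  exists s, c; split=> // i; case: (unliftP ord0 i) => [j ->|->] //.
  by rewrite g0 mulr0; have [] := submodule_principal c.
have [Rx|nRx] := pselect (localize M DK (c / g ord0)).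
  have [t [tD Mt] tx] := Rx.
  exists (t * s), (g ord0); split; auto; first exact: prime_notM.
    exact: mem_generated.
  move=> i; case: (unliftP ord0 i) => [j ->|->]; last by exists (t * s); auto.
  have [d dD dE] := Hg j; exists (d * (t * (c / g ord0))); first exact: domM.
  by rewrite !mulrA divfK // -[t * s * _]mulrA -dE mulrA [d * t]mulrC.
have c0 : c != 0.
  by apply/eqP => c0; apply: nRx; rewrite c0 mul0r; exact: localize_dom.
case: (VM (c / g ord0)) => [||[t [tD Mt] tx]] //.
  exact: div_neq0.
exists (t * s), c; split; auto; first exact: prime_notM.
have [P0 PA PM] := submodule_principal c.
move=> i; case: (unliftP ord0 i) => [j ->|->].
  by rewrite -mulrA; exact: PM.
exists (s * (t * (c / g ord0)^-1)); first exact: domM.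
by rewrite invf_div !mulrA divfK // [s * t]mulrC.
Qed.

(** By finite type x lies in the closure of a finitely generated part of A, and
    up to a factor s outside M that part lies in a principal ideal, which is
    closed. *)
Lemma star_sub_localize M A : prime_ideal M ->
    valuation_overring (localize M DK) -> nonzero_ideal A ->
  star A `<=` localize M A.
Proof.
move=> pM VM HA x /(star_finitary HA)[n [g [Ag gN gx]]].
have [s [c [sD Ms gc sg]]] := generated_locally_principal g pM VM.
have [[[A0 _ AM] AD] _] := HA; have s0 := prime_neq0 pM Ms.
have gA : generated_by g `<=` A by apply: generated_sub => //; case: HA => [[]].
have c0 : c != 0.
  have [_ [y gy y0]] := gN; have [d _ dE] := sg y gy.
  apply: contra_neq y0 => c0; apply: (mulfI s0).
  by rewrite mulr0 -dE c0 mulr0.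
have cD := AD _ (gA _ gc).
have : ideal_scale s (star (generated_by g)) (s * x) by exists x.
rewrite -star_scale_ideal // => /(star_min _ (star_ideal_principal cD c0))[].
- exact: nonzero_ideal_scale.
- by move=> _ [y gy <-]; exact: sg.
- by move=> d dD dE; exists s => //; rewrite -dE; apply: AM => //; exact: gA.
Qed.

(** For x = a/b, invertibility of J = (a, b) gives an e in the inverse of J such
    that a e or b e is outside M; this one then divides the other in D_M. *)
Lemma PstarMD_valuation M : PstarMD star -> prime_star_ideal star M ->
  valuation_overring (localize M DK).
Proof.
move=> HD [pM sM]; split; first exact: overring_localize.
move=> x x0; have [a [b [aD bD b0 xE]]] := frac_dom x.
have a0 : a != 0 by apply: contra_neq x0 => a0; rewrite xE a0 mul0r.
apply: contrapT => /not_orP[nx nxV].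
pose g (i : 'I_2) := if i == ord0 then a else b.
have gN : nonzero_ideal (generated_by g).
  split; last by exists a => //; exact: (mem_generated g ord0).
  split; first exact: submodule_generated.
  by apply: generated_sub submodule_dom _ => i; rewrite /g; case: eqP.
have [||_ sE] := HD (generated_by g); [|by have [[]] := gN|].
  by split; [exact: frac_of|exists 2%N, g].
apply: (prime_star_not_sub _ (conj pM sM) sE).
  exact: nonzero_ideal_mul_inv.
have [M0 MA MM] : submodule M by case: pM => [[]].
apply: ideal_mul_sub => // _ e [d dD ->] eI.
have eD c : generated_by g c -> DK (c * e).
  by move=> gc; apply: eI; exists c; rewrite // mulrC.
have ae : DK (a * e) by exact/eD/(mem_generated g ord0).
have be : DK (b * e) by exact/eD/(mem_generated g ord_max).
rewrite big_ord_recl big_ord1 /g /= mulrDl -!mulrA.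
apply: (MA); apply: (MM) => //; apply: contrapT => Me.
  apply: nxV; exists (a * e) => //.
  by rewrite xE invf_div mulrC mulrA divfK.
apply: nx; exists (b * e) => //.
by rewrite xE mulrC mulrA divfK.
Qed.

(** With s J inside c D, the element s = c (s/c) of J times its inverse is
    outside M. *)
Lemma valuation_PstarMD :
  (forall M, maximal_star_ideal star M -> valuation_overring (localize M DK)) ->
  PstarMD star.
Proof.
move=> HM J [HJ [n [g JE]]] JD; split=> //.
have JN := fractional_nonzero_ideal HJ JD.
apply: star_eq_dom => [|M mM JM]; first exact: nonzero_ideal_mul_inv.
have [pM _] := maximal_star_ideal_prime mM.
have [s [c [sD Ms gc sg]]] := generated_locally_principal g pM (HM M mM).
have s0 := prime_neq0 pM Ms.
have c0 : c != 0.
  have [_ [y]] := JN; rewrite JE => gy y0; have [d _ dE] := sg y gy.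
  apply: contra_neq y0 => c0; apply: (mulfI s0).
  by rewrite mulr0 -dE c0 mulr0.
apply: Ms; apply: JM; have -> : s = c * (s / c) by rewrite mulrC divfK.
apply: mem_ideal_mul; first by rewrite JE.
move=> _ [y Jy <-]; have [|d dD dE] := sg y; first by rewrite -JE.
by rewrite mulrAC -dE mulfK.
Qed.

Lemma overringM V x y : overring V -> V x -> V y -> V (x * y).
Proof. by case=> _ _ VM; exact: VM. Qed.

Lemma overring_dom V x : overring V -> DK x -> V x.
Proof. by case=> DV _ _; exact: DV. Qed.

Lemma overringX V x n : overring V -> V x -> V (x ^+ n).
Proof.
move=> oV Vx; elim: n => [|n IH]; first exact: overring_dom.
by rewrite exprS; exact: overringM.
Qed.

(** * Treed domains whose primes contain invertible valuation ideals *)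

(** The condition reads c V meet D_M = c D_M, divided through by c. *)
Definition valuation_element M c : Prop :=
  [/\ DK c, c != 0 & exists2 V, valuation_overring V
    & forall x, localize M DK x -> V (x / c) -> localize M DK (x / c)].

Section Treed.
Hypothesis treed : star_treed star.
Hypothesis prime_contains : forall P, prime_star_ideal star P ->
  exists I, [/\ valuation_ideal I, star_invertible star I & I `<=` P].
Variable M : set K.
Hypothesis Mstar : prime_star_ideal star M.
Let pM : prime_ideal M := proj1 Mstar.
Local Notation R := (localize M DK).
Let RM := localize_domM pM.
Let RX := localize_domX pM.
Let RD := localize_dom pM.

(** Say that no power of b is divisible by a in D_M. Then the products s b^n with
    s outside M avoid the ideal (a), which yields a prime star ideal inside M
    that contains a but not b. If no power of a is divisible by b either, this
    gives two incomparable primes inside M. *)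
Lemma treed_powers a b : DK a -> a != 0 -> DK b -> b != 0 ->
  (exists n, R (b ^+ n / a)) \/ (exists n, R (a ^+ n / b)).
Proof.
have avoid c d : DK c -> c != 0 -> DK d -> d != 0 ->
    ~ (exists n, R (d ^+ n / c)) ->
    exists P, [/\ prime_star_ideal star P, P `<=` M, P c & ~ P d].
  move=> cD c0 dD d0 nR.
  pose T := [set y | exists s n, [/\ DK s, ~ M s & y = s * d ^+ n]].
  have [|||_ [s [n [sD Ms ->]]] [e eD eE]|P [HP cP PT]] :=
    prime_star_ideal_avoiding_elements (T := T) _ _ _
      (star_ideal_principal cD c0).
  - by move=> _ [s [n [sD Ms ->]]]; auto.
  - by exists 1, 0%N; rewrite mul1r; split=> //; exact: prime_not1.
  - move=> _ _ [s [n [sD Ms ->]]] [t [m [tD Mt ->]]].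
    exists (s * t), (n + m)%N; rewrite exprD mulrACA; split; auto.
    exact: prime_notM.
  - by apply: nR; exists n, s; rewrite // mulrA -eE mulfK.
  exists P; split=> //.
  - move=> p Pp; apply: contrapT => Mp; apply: (PT p) => //.
    exists p, 0%N; rewrite mulr1; split=> //.
    by have [pP _] := HP; exact: prime_dom Pp.
  - by apply: cP; exact: mem_principal.
  - apply: PT; exists 1, 1%N; rewrite mul1r; split=> //; exact: prime_not1.
move=> aD a0 bD b0; apply: contrapT => /not_orP[na nb].
have [P [HP PM Pa Pb]] := avoid a b aD a0 bD b0 na.
have [Q [HQ QM Qb Qa]] := avoid b a bD b0 aD a0 nb.
by case: (treed Mstar HP HQ PM QM) => [PQ|QP]; [apply: Qa; exact: PQ|apply: Pb; exact: QP].
Qed.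

(** If c does not divide b then c/b is in V. In that case c^(k+2)/b in D_M is c
    times an element c^(k+1)/b of V, so it lies in c V meet D_M = c D_M; thus
    the exponent can be lowered until c/b itself is in D_M. *)
Lemma valuation_element_root c b n :
    valuation_element M c -> DK b -> b != 0 -> R (c ^+ n / b) ->
  R (b / c) \/ R (c / b).
Proof.
move=> [cD c0 [V [oV VV] HV]] bD b0 Rn.
have [|Vbc|] := VV (b / c); first exact: div_neq0.
  by left; apply: HV => //; exact: RD.
rewrite invf_div => Vcb; right.
have {Rn} : R (c ^+ n.+1 / b) by rewrite exprS -mulrA; apply: RM => //; exact: RD.
elim: n => [|n IH Rn]; first by rewrite expr1.
have E : c ^+ n.+2 / b / c = c ^+ n.+1 / b.
  by rewrite exprS -[c * _ / b]mulrA [c * _]mulrC mulfK.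
apply: IH; rewrite -E; apply: HV => //; rewrite E exprSr -mulrA.
by apply: overringM => //; apply: overringX => //; exact: overring_dom.
Qed.

Lemma valuation_element_dvd c b :
  valuation_element M c -> DK b -> b != 0 -> R (c / b) -> valuation_element M b.
Proof.
move=> [cD c0 [V VV HV]] bD b0 Rcb; split=> //; exists V => // x Rx Vx.
have E : x / b = (c / b) * x / c.
  by rewrite mulrAC [c / b]mulrC mulfK // mulrC.
by rewrite E; apply: HV; [exact: RM | rewrite -E].
Qed.

(** Let T be the set of all d no power of which is divisible by b. It is closed
    under products: if x divides y^n, then y^(n m + m) is a multiple of
    (x y)^m. A prime star ideal over b avoiding T contains an invertible
    valuation ideal, and a local generator c of that ideal at M is a valuation
    element outside T. *)
Lemma valuation_element_above b : DK b -> b != 0 ->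
  exists d, valuation_element M d /\ exists m, R (d ^+ m / b).
Proof.
move=> bD b0; have [Mb|Mb] := pselect (M b); last first.
  exists 1; split; last by exists 0%N, b; rewrite // mulrCA mul1r mulfV.
  split=> //; first exact: oner_neq0.
  exists setT; first by split; [split | left].
  by move=> x Rx _; rewrite divr1.
apply: contrapT => nd.
pose T := [set d | DK d /\ forall m, ~ R (d ^+ m / b)].
have T0 x : T x -> x != 0.
  move=> [_ /(_ 1%N) nx]; apply/eqP => x0; apply: nx.
  by rewrite x0 mul0r; exact: RD.
have [|||t [tD nt] [d dD dE]|P [HP bP PT]] :=
  prime_star_ideal_avoiding_elements (T := T) _ _ _
    (star_ideal_principal bD b0).
- by move=> x [].
- split=> // m; rewrite expr1n mul1r => -[s [sD Ms] sb]; apply: Ms.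
  by rewrite -(divfK b0 s); exact: primeM.
- suff half x y m n : x != 0 -> R (y ^+ n / x) -> R ((x * y) ^+ m / b) ->
      R (y ^+ (n * m + m) / b).
    move=> x y Tx Ty; have [[xD nx] [yD ny]] := (Tx, Ty).
    split=> [|m Rm]; first exact: domM.
    have [[n Rn]|[n Rn]] := treed_powers xD (T0 x Tx) yD (T0 y Ty).
      by apply: ny; exact: half _ _ _ _ (T0 x Tx) Rn Rm.
    by apply: nx; rewrite [x * y]mulrC in Rm; exact: half _ _ _ _ (T0 y Ty) Rn Rm.
  move=> x0 Rn Rm.
  have -> : y ^+ (n * m + m) / b = (y ^+ n / x) ^+ m * ((x * y) ^+ m / b).
    rewrite exprD exprM expr_div_n exprMn !mulrA divfK ?expf_neq0 //.
  exact: RM (RX m Rn) Rm.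
- apply: (nt 1%N); rewrite expr1 -dE mulfK //; exact: RD.
have [I [[[_ ID] [V [oV VV] IV]] [IF Iinv] IP]] := prime_contains HP.
have IN := fractional_nonzero_ideal IF ID.
have := prime_star_not_sub (nonzero_ideal_mul_inv IN) Mstar Iinv.
apply; apply: ideal_mul_sub; [exact: prime0 | by case: pM => [[[]]]|].
move=> c e Ic eI; apply: contrapT => Mce.
have eD x : I x -> DK (x * e) by move=> Ix; apply: eI; exists x; rewrite // mulrC.
have c0 : c != 0.
  by apply/eqP => c0; apply: Mce; rewrite c0 mul0r; exact: prime0.
apply: (PT c); last exact: IP.
split; first exact: ID.
move=> m Rm; apply: nd; exists c; split; last by exists m.
split=> //; [exact: ID|exists V => // x [s [sD Ms] sx] Vx].
have Ix : I (s * x).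
  rewrite -IV; split=> //; have -> : s * x = c * (s * (x / c)).
    by rewrite mulrCA [c * _]mulrC divfK.
  by apply: mem_ideal_mul => //; apply: overringM => //; exact: overring_dom.
exists (c * e * s); first by split; [auto|apply: prime_notM; auto].
have -> : c * e * s * (x / c) = s * x * e.
  have -> : c * e * s * (x / c) = (x / c) * c * (s * e) by ring.
  by rewrite divfK //; ring.
exact: eD.
Qed.

(** The remaining case of [valuation_element_root] is that c divides a power of
    b. A valuation element d some power of which is a multiple of b then also
    has a power divisible by c, so d is comparable with both b and c, and the
    position of d settles the question. *)
Lemma valuation_element_comparable c b :
  valuation_element M c -> DK b -> b != 0 -> R (b / c) \/ R (c / b).
Proof.
move=> vc bD b0; have [cD c0 _] := vc.
have [[n Rn]|[n Rn]] := treed_powers bD b0 cD c0.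
  exact: valuation_element_root Rn.
have [d [vd [m Rm]]] := valuation_element_above bD b0; have [dD d0 _] := vd.
have Rmn : R (d ^+ (m * n) / c).
  have -> : d ^+ (m * n) / c = (d ^+ m / b) ^+ n * (b ^+ n / c).
    by rewrite expr_div_n exprM mulrA (divfK (expf_neq0 n b0)).
  exact: RM (RX n Rm) Rn.
have [Rbd|Rdb] := valuation_element_root vd bD b0 Rm; last first.
  by apply/or_comm; apply: valuation_element_root Rn => //;
    exact: valuation_element_dvd Rdb.
have [Rcd|Rdc] := valuation_element_root vd cD c0 Rmn.
  apply: valuation_element_root vc bD b0 (_ : R (c ^+ m / b)).
  have -> : c ^+ m / b = (c / d) ^+ m * (d ^+ m / b).
    by rewrite expr_div_n mulrA (divfK (expf_neq0 m d0)).
  exact: RM (RX m Rcd) Rm.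
left; have -> : b / c = b / d * (d / c) by rewrite mulrA divfK.
exact: RM.
Qed.

(** Elements comparable with everything are closed under products and divisors,
    and every element divides a power of a valuation element. *)
Lemma valuation_localize : valuation_overring R.
Proof.
split; first exact: overring_localize.
move=> x x0; have [a [b [aD bD b0 xE]]] := frac_dom x.
have a0 : a != 0 by apply: contra_neq x0 => a0; rewrite xE a0 mul0r.
have [d [vd [m [s [sD Ms] smD]]]] := valuation_element_above bD b0.
have [dD d0 _] := vd; have s0 := prime_neq0 pM Ms.
have powers k y : DK y -> y != 0 -> R (y / d ^+ k) \/ R (d ^+ k / y).
  elim: k y => [|k IH] y yD y0; first by left; rewrite divr1; exact: RD.
  have [[t [tD Mt] ty]|Rdy] := valuation_element_comparable vd yD y0; last first.
    by right; rewrite exprSr -mulrA; apply: RM => //; exact/RD/domX.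
  have t0 := prime_neq0 pM Mt.
  have [|Ry|Ry] := IH _ ty; first exact: mulf_neq0 t0 (div_neq0 y0 d0).
    left; apply: (localize_inv pM tD Mt); move: Ry.
    by rewrite exprS invfM !mulrA.
  right; have -> : d ^+ k.+1 / y = t * (d ^+ k / (t * (y / d))).
    rewrite !invfM invrK exprS; have -> : t * (d ^+ k * (t^-1 * (y^-1 * d))) =
      t * t^-1 * (d * d ^+ k / y) by ring.
    by rewrite mulfV // mul1r.
  by apply: RM => //; exact: RD.
(* e is the cofactor of b in s d^m: comparing e a with d^m amounts to
   comparing a with b. *)
set e := s * (d ^+ m / b) in smD.
have e0 : e != 0 := mulf_neq0 s0 (div_neq0 (expf_neq0 m d0) b0).
have E : e * a / d ^+ m = s * x.
  rewrite /e xE; have -> : s * (d ^+ m / b) * a / d ^+ m =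
    d ^+ m / d ^+ m * (s * (a / b)) by ring.
  by rewrite mulfV ?expf_neq0 // mul1r.
have [||Rx|Rx] := powers m (e * a); [exact: domM|exact: mulf_neq0| |].
  by left; apply: (localize_inv pM sD Ms); rewrite -E.
right; have -> : x^-1 = s * (d ^+ m / (e * a)).
  by rewrite -[d ^+ m / _]invf_div E invfM mulrA mulfV // mul1r.
by apply: RM => //; exact: RD.
Qed.

End Treed.

(** * Finite character *)

(** This makes the radical of a valuation ideal prime: if u/v is in V then
    u^2 = u v (u/v) lies in I V. *)
Lemma valuation_ideal_sqr I u v : valuation_ideal I ->
  DK u -> DK v -> u != 0 -> v != 0 -> I (u * v) -> I (u ^+ 2) \/ I (v ^+ 2).
Proof.
move=> [_ [V [oV VV] IV]] uD vD u0 v0 Iuv.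
have half x y : DK x -> x != 0 -> I (y * x) -> V (y / x) -> DK y -> I (y ^+ 2).
  move=> xD x0 Iyx Vyx yD; rewrite -IV; split; last exact: domX.
  have -> : y ^+ 2 = y * x * (y / x) by rewrite mulrA mulrAC mulfK.
  exact: mem_ideal_mul.
have [|Vuv|] := VV (u / v); first exact: div_neq0.
  by left; apply: half Vuv _.
by rewrite invf_div mulrC in Iuv * => Vvu; right; apply: half Vvu _.
Qed.

(** Suppose x is in M only and y in N only. If c generates I at N, then y
    divides c in D_N, say with quotient s c/y; were x/y in V, the element
    x s c/y of D would lie in c V, hence in I, hence in c D_N, making y a unit
    there. So x/y is not in V, and by symmetry neither is y/x. *)
Lemma invertible_valuation_ideal_primes I M N :
    prime_star_ideal star M -> prime_star_ideal star N ->
    valuation_overring (localize M DK) -> valuation_overring (localize N DK) ->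
    valuation_ideal I -> star_invertible star I -> I `<=` M -> I `<=` N ->
  M `<=` N \/ N `<=` M.
Proof.
move=> HM HN VM VN vI [IF Iinv] IM IN.
have [[sI ID] [V [oV VV] IV]] := vI.
have I0 := fractional_nonzero_ideal IF ID.
have key P Q x y : prime_star_ideal star P -> prime_star_ideal star Q ->
    valuation_overring (localize Q DK) -> I `<=` P -> I `<=` Q ->
    DK x -> ~ Q x -> Q y -> ~ P y -> ~ V (x / y).
  move=> [pP _] HQ [_ VQ] IP IQ xD Qx Qy Py Vxy; have [pQ _] := HQ.
  have yD := prime_dom pQ Qy; have y0 := prime_neq0 pP Py.
  have [c [e [Ic eI Qce]]] : exists c e, [/\ I c, ideal_inv I e & ~ Q (c * e)].
    apply: contrapT => nce.
    apply: (prime_star_not_sub (nonzero_ideal_mul_inv I0) HQ Iinv).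
    apply: ideal_mul_sub; [exact: prime0 | by case: pQ => [[[]]]|].
    by move=> c e Ic eI; apply: contrapT => Qce; apply: nce; exists c, e.
  have eD z : I z -> DK (z * e) by move=> Iz; apply: eI; exists z; rewrite // mulrC.
  have c0 : c != 0.
    by apply/eqP => c0; apply: Qce; rewrite c0 mul0r; exact: prime0.
  have [|[s [sD Qs] sy]|] := VQ (y / c); first exact: div_neq0.
    have Isy : I (s * y).
      have -> : s * y = s * (y / c) * c by rewrite -mulrA divfK.
      by case: sI => _ _ IM'; exact: IM'.
    have [Is|Iy] := valuation_ideal_sqr vI sD yD (prime_neq0 pQ Qs) y0 Isy.
      by apply: Qs; apply: (prime_X pQ sD (IQ _ Is)).
    by apply: Py; apply: (prime_X pP yD (IP _ Iy)).
  rewrite invf_div => -[s [sD Qs] scD].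
  have Iz : I (x * (s * (c / y))).
    rewrite -IV; split; last exact: domM.
    have -> : x * (s * (c / y)) = c * (s * (x / y)) by ring.
    by apply: mem_ideal_mul => //; apply: overringM => //; exact: overring_dom.
  have : Q (y * (x * (s * (c / y)) * e)) by apply: primeMr => //; exact: eD.
  have -> : y * (x * (s * (c / y)) * e) = y / y * (x * s * (c * e)) by ring.
  rewrite mulfV // mul1r; apply: prime_notM => //; auto.
  exact: prime_notM.
apply: contrapT => /not_orP[/existsNP[x /not_implyP[Mx Nx]]].
move=> /existsNP[y /not_implyP[Ny My]].
have xD := prime_dom (proj1 HM) Mx; have yD := prime_dom (proj1 HN) Ny.
have [||] := VV (x / y).
- have x0 := prime_neq0 (proj1 HN) Nx; have y0 := prime_neq0 (proj1 HM) My.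
  exact: div_neq0.
- exact: (key M N).
- by rewrite invf_div; exact: (key N M).
Qed.

(** Only finitely many elements of I are involved in an expression putting 1 in
    the closure of I times its inverse. If C is the ideal they generate, then
    for x in I the multiple by x of C times the inverse of I lies in C. *)
Lemma invertible_sub_star I : nonzero_ideal I -> star_invertible star I ->
  exists n (g : 'I_n -> K), [/\ forall i, I (g i), nonzero_ideal (generated_by g)
    & I `<=` star (generated_by g)].
Proof.
move=> HI [_ Iinv]; have HII := nonzero_ideal_mul_inv HI.
have [[sI ID] [x0 Ix0 x00]] := HI.
have [n [g [gI gN g1]]] : exists n (g : 'I_n -> K), [/\ forall i,
    ideal_mul I (ideal_inv I) (g i), nonzero_ideal (generated_by g)
    & star (generated_by g) 1] by apply: star_finitary; rewrite ?Iinv.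
have [m [h [hI hx0 gh]]] : exists m (h : 'I_m -> K), [/\ forall i, I (h i),
    generated_by h x0 & forall i, ideal_mul (generated_by h) (ideal_inv I) (g i)].
  elim: n g gI {gN g1} => [|n IH] g gI.
    by exists 1%N, (fun=> x0); split=> // [|[]//]; exact: (mem_generated _ ord0).
  have [m [h [hI hx0 gh]]] := IH (fun i => g (lift ord0 i)) (fun i => gI _).
  have [k [a [b [aI bI gE]]]] := gI ord0.
  have [l [u [uI hu au]]] := generated_directed hI aI.
  have umul v x : generated_by v `<=` generated_by u ->
      ideal_mul (generated_by (v : 'I_(_) -> K)) (ideal_inv I) x ->
      ideal_mul (generated_by u) (ideal_inv I) x.
    by move=> vu [p [c [d [cv dI ->]]]]; exists p, c, d; split=> // i; exact: vu.
  exists l, u; split=> // [|i]; first exact: hu.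
  case: (unliftP ord0 i) => [j ->|->]; first exact: umul hu (gh j).
  apply: (umul _ a) => //; exists k, a, b; split=> // j; exact: mem_generated.
have hsub : generated_by h `<=` I by exact: generated_sub.
have hN : nonzero_ideal (generated_by h).
  split; last by exists x0.
  by split; [exact: submodule_generated | exact: subset_trans ID].
exists m, h; split=> // x Ix.
have [->|xn0] := eqVneq x 0; first by have [[[]]] := nonzero_ideal_star hN.
have sP : submodule (ideal_mul (generated_by h) (ideal_inv I)).
  by apply: submodule_ideal_mul; have [] := submodule_generated h.
have hIN : nonzero_ideal (ideal_mul (generated_by h) (ideal_inv I)).
  split; last first.
    exists x0 => //; rewrite -[x0]mulr1; apply: mem_ideal_mul => //.
    by move=> _ [y /ID yD <-]; rewrite mul1r.
  split=> //; apply: ideal_mul_sub; auto => c e /hsub Ic; apply.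
  by exists c; rewrite // mulrC.
have s1 : star (ideal_mul (generated_by h) (ideal_inv I)) 1.
  by apply: (star_le gN hIN) g1; exact: generated_sub.
have : ideal_scale x (star (ideal_mul (generated_by h) (ideal_inv I))) x.
  by exists 1; rewrite ?mulr1.
rewrite -star_scale_ideal //; apply: star_le => //.
  by apply: nonzero_ideal_scale => //; exact: ID.
have [h0 hD hM] := submodule_generated h.
move=> _ [y hy <-]; move: y hy.
apply: (@ideal_mul_sub _ _ [set y | generated_by h (x * y)]).
- by rewrite /= mulr0.
- by move=> y z /= hy hz; rewrite mulrDr; exact: hD.
- move=> c e hc eI /=; rewrite mulrCA mulrC; apply: hM => //.
  by apply: eI; exists x; rewrite // mulrC.
Qed.

Section HLocal.
Hypothesis valuation_at : forall M, maximal_star_ideal star M ->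
  valuation_overring (localize M DK).
Hypothesis prime_contains : forall P, prime_star_ideal star P ->
  exists I, [/\ valuation_ideal I, star_invertible star I & I `<=` P].

Lemma invertible_valuation_ideal_maximal I M N :
    maximal_star_ideal star M -> maximal_star_ideal star N ->
    valuation_ideal I -> star_invertible star I -> I `<=` M -> I `<=` N ->
  M = N.
Proof.
move=> mM mN vI iI IM IN.
have [[HM MD Mmax] [HN ND Nmax]] := (mM, mN).
case: (invertible_valuation_ideal_primes (maximal_star_ideal_prime mM)
  (maximal_star_ideal_prime mN) (valuation_at mM) (valuation_at mN) vI iI IM IN).
  by move=> MN; rewrite (Mmax N).
by move=> NM; rewrite (Nmax M).
Qed.

Lemma h_local_of_prime_contains : star_h_local star.
Proof.
split; last first.
  move=> P HP; have [I [vI iI IP]] := prime_contains HP.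
  have [[_ PD _] sP] := HP.
  have [M [mM _] PM] := exists_maximal_star_ideal sP PD.
  exists M; split=> // N [mN PN].
  by apply: invertible_valuation_ideal_maximal vI iI _ _ => //; exact: subset_trans IP _.
move=> a' a0 _; set a := tofrac a'.
have {a0} a0 : a != 0 by rewrite tofrac_eq0.
have aD : DK a by exists a'.
(* Ideals inside (a) lie in all the maximal star ideals containing a, so if
   these are infinitely many then (a) has no subideal in T. *)
pose T := [set C | [/\ nonzero_ideal C, exists n (g : 'I_n -> K), C = generated_by g
   & finite_set [set M | maximal_star_ideal star M /\ C `<=` M]]].
apply: contrapT => na.
have notT C : T C -> ~ C `<=` principal a.
  move=> [_ _ Cfin] Ca; apply: na; apply: sub_finite_set Cfin => M [mM Ma].
  split=> //; apply: subset_trans Ca _; apply: principal_sub => //.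
  by have [[[]]] := maximal_star_ideal_prime mM.
have [C []//|||P [HP aP PT _]] :=
  prime_star_ideal_avoiding (T := T) _ _ _ (star_ideal_principal aD a0) notT.
- exists (principal 1); last exact: principal_sub submodule_dom _.
  split; first by apply: nonzero_ideal_principal; rewrite ?oner_eq0.
    by exists 1%N, (fun=> 1); exact: principal_generated.
  apply: (sub_finite_set _ (@finite_set0 _)) => M [mM M1].
  have [pM _] := maximal_star_ideal_prime mM.
  by apply: (prime_not1 pM); apply: M1; exact: mem_principal.
- move=> B C [HB Bfg Bfin] [HC Cfg Cfin]; exists (ideal_mul B C) => //.
  split; first exact: nonzero_ideal_mul.
    have [[n [g ->]] [m [h ->]]] := (Bfg, Cfg).
    by have [k [u ->]] := ideal_mul_generated g h; exists k, u.
  apply: (@sub_finite_set _ _ ([set M | maximal_star_ideal star M /\ B `<=` M] `|`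
    [set M | maximal_star_ideal star M /\ C `<=` M])); last by rewrite finite_setU.
  move=> M [mM BCM]; have [pM _] := maximal_star_ideal_prime mM.
  apply: contrapT => /not_orP[/not_andP[//|/existsNP[b /not_implyP[Bb Mb]]]].
  move=> /not_andP[//|/existsNP[c /not_implyP[Cc Mc]]].
  have bD : DK b by have [[_ BD] _] := HB; exact: BD.
  have cD : DK c by have [[_ CD] _] := HC; exact: CD.
  apply: (prime_notM pM bD Mb cD Mc); apply: BCM; exact: mem_ideal_mul.
have [I [vI iI IP]] := prime_contains HP.
have [[_ ID] _] := vI; have IN := fractional_nonzero_ideal (proj1 iI) ID.
have [n [g [Ig gN Istar]]] := invertible_sub_star IN iI.
have [[sI _] _] := vI.
apply: (PT (generated_by g)); last first.
  by apply: subset_trans IP; exact: generated_sub.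
split=> //; first by exists n, g.
have [[M [mM gM]]|none] := pselect (exists M, maximal_star_ideal star M /\
    generated_by g `<=` M).
  apply: (sub_finite_set _ (finite_set1 M)) => N [mN gN'] /=.
  have IsubM N' : maximal_star_ideal star N' -> generated_by g `<=` N' -> I `<=` N'.
    move=> [HN' _ _] gN''; apply: subset_trans Istar _; exact: star_min.
  by apply: invertible_valuation_ideal_maximal vI iI _ _ => //; exact: IsubM.
by apply: (sub_finite_set _ (@finite_set0 _)) => M HM; apply: none; exists M.
Qed.

End HLocal.


(** * Factorizations *)

(** With p the product of elements of the other factors, p/a is in the inverse of
    the i-th factor. Hence the whole product lies in a times the i-th factor
    times its inverse, and taking closures shows that 1 is in the closure of
    the latter. *)
Lemma star_product_factor_invertible n (I : 'I_n -> set K) a i :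
    (forall i, nonzero_ideal (I i)) -> a != 0 ->
  principal a = star (ideal_prod I) -> star_invertible star (I i).
Proof.
move=> HI a0 aE; split; first exact: frac_of.
have HII := nonzero_ideal_mul_inv (HI i).
have HP := nonzero_ideal_prod HI.
have aD : DK a.
  by apply: (star_sub_dom HP); rewrite -aE; exact: mem_principal.
apply: (ideal_one (nonzero_ideal_star HII)).
have sub : ideal_prod I `<=` ideal_scale a (ideal_mul (I i) (ideal_inv (I i))).
  have HS := nonzero_ideal_scale aD a0 HII.
  apply: ideal_prod_sub => [|t It]; first by case: HS => [[]].
  rewrite (bigD1 i) //=; set p := \prod_(j < n | j != i) t j.
  exists (t i * (p / a)); last by rewrite mulrCA [a * _]mulrC divfK.
  apply: mem_ideal_mul => // _ [x Ix <-].
  pose u j := if j == i then x else t j.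
  have : principal a (\prod_(j < n) u j).
    rewrite aE; apply: (sub_star HP); apply: mem_ideal_prod => j.
    by rewrite /u; case: eqP => [->|].
  rewrite (bigD1 i) //= {1}/u eqxx.
  have -> : \prod_(j < n | j != i) u j = p.
    by apply: eq_bigr => j /negPf ji; rewrite /u ji.
  by move=> [d dD dE]; rewrite mulrAC [p * x]mulrC -dE mulfK.
have := star_le HP (nonzero_ideal_scale aD a0 HII) sub.
rewrite -aE star_scale_ideal // => /(_ a (mem_principal a))[y ys].
by rewrite -{2}[a]mulr1 => /(mulfI a0) <-.
Qed.

(** Comaximality leaves at most one factor I i inside P. The others contain
    elements outside P, whose product p satisfies p (I i) inside (a b). On the
    other side, the product of the factors does not lie in a b P, since the
    latter is closed and misses a b; this gives s outside P with a b s in I i.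
    So I i and (a b) agree at P, and c^2 s = a b s (c/d) is the key identity for
    c d = a b and c/d in V. *)
Lemma comaximal_factorization_valuation P :
    (forall a : D, a != 0 ->
       star_product_of_comaximal_valuation_ideals star (principal (tofrac a))) ->
    prime_star_ideal star P ->
  valuation_overring (localize P DK).
Proof.
move=> Hfac HP; have [pP sP] := HP; split; first exact: overring_localize.
move=> x x0; have [a [b [aD bD b0 xE]]] := frac_dom x.
have a0 : a != 0 by apply: contra_neq x0 => a0; rewrite xE a0 mul0r.
have ab0 : a * b != 0 by rewrite mulf_neq0.
have [n [I [_ HI vI Icom abE]]] : star_product_of_comaximal_valuation_ideals star
    (principal (a * b)).
  have [c _ cE] := domM aD bD; rewrite -cE; apply: Hfac.
  by rewrite -tofrac_eq0 cE.
have HIP := nonzero_ideal_prod HI.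
have prodab y : ideal_prod I y -> principal (a * b) y.
  by move=> Iy; rewrite abE; exact: sub_star Iy.
have [[i IiP]|none] := pselect (exists i, I i `<=` P); last first.
  have pick i : exists t, I i t /\ ~ P t.
    apply: contrapT => nt; apply: none; exists i => t It.
    by apply: contrapT => Pt; apply: nt; exists t.
  have [t Ht] := choice pick.
  have [pD Pp] : DK (\prod_(i < n) t i) /\ ~ P (\prod_(i < n) t i).
    apply: prime_not_prod => // i _; have [It Pt] := Ht i.
    by split=> //; have [[_ ID] _] := HI i; exact: ID.
  have [d dD dE] := prodab _ (mem_ideal_prod (fun i => proj1 (Ht i))).
  left; exists (\prod_(i < n) t i) => //.
  rewrite -dE xE; have -> : d * (a * b) * (a / b) = d * (a * a) * (b / b) by ring.
  by rewrite mulfV // mulr1; auto.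
have [y [Iy [s [sD Ps yE]]]] : exists y, ideal_prod I y /\
    exists s, [/\ DK s, ~ P s & y = a * b * s].
  apply: contrapT => ny.
  have sub : ideal_prod I `<=` ideal_scale (a * b) P.
    move=> y Iy; have [d dD dE] := prodab y Iy.
    exists d; last by rewrite mulrC.
    apply: contrapT => Pd; apply: ny; exists y; split=> //.
    by exists d; split; rewrite // mulrC.
  have PN := star_ideal_nonzero sP.
  have := star_le HIP (nonzero_ideal_scale (domM aD bD) ab0 PN) sub.
  rewrite -abE star_scale_ideal // => /(_ _ (mem_principal _))[z].
  case: sP => _ _ -> Pz; rewrite -{2}[a * b]mulr1 => /(mulfI ab0) z1.
  by apply: (prime_not1 pP); rewrite -z1.
(* At the index i itself any value will do. *)
have pick j : exists t, j != i -> I j t /\ ~ P t.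
  have [->|ji] := eqVneq j i; first by exists 0.
  apply: contrapT => nt; apply: (prime_star_not_sub
    (nonzero_ideal_add (HI j) (HI i)) HP (Icom _ _ ji)).
  have [P0 PA _] : submodule P by case: pP => [[]].
  move=> _ [u Iu [v Iv <-]]; apply: PA; last exact: IiP.
  by apply: contrapT => Pu; apply: nt; exists u.
have [t Ht] := choice pick.
set p := \prod_(j < n | j != i) t j.
have [pD Pp] : DK p /\ ~ P p.
  apply: prime_not_prod => // j /Ht[It Pt]; split=> //.
  by have [[_ ID] _] := HI j; exact: ID.
have Iprod z : I i z -> principal (a * b) (z * p).
  move=> Iz; apply: prodab; pose u j := if j == i then z else t j.
  have := @mem_ideal_prod _ I u; rewrite (bigD1 i) //= {2}/u eqxx.
  have -> : \prod_(j < n | j != i) u j = p.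
    by apply: eq_bigr => j /negPf ji; rewrite /u ji.
  by apply=> j; rewrite /u; case: eqVneq => [->|/Ht[]].
have Iiy : I i (a * b * s) by rewrite -yE; exact: ideal_prod_factor Iy.
have [_ [V [oV VV] IV]] := vI i.
have half c d : c * d = a * b -> DK c -> DK d -> c != 0 -> d != 0 -> V (c / d) ->
    localize P DK (c / d).
  move=> cdE cD dD c0 d0 Vcd.
  have Ic : I i (c * c * s).
    rewrite -IV; split; last by auto.
    have -> : c * c * s = a * b * s * (c / d).
      rewrite -cdE; have -> : c * d * s * (c / d) = d / d * (c * c * s) by ring.
      by rewrite mulfV // mul1r.
    exact: mem_ideal_mul.
  have [e eD eE] := Iprod _ Ic; exists (s * p).
    by split; [exact: domM | exact: prime_notM].
  rewrite -cdE in eE; have -> : s * p * (c / d) = c * (s * p / d) by ring.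
  have -> : s * p / d = e / c.
    apply: (mulfI c0); rewrite [RHS]mulrC divfK //; apply: (mulfI c0).
    have -> : c * (c * (s * p / d)) = c * c * s * p / d by ring.
    by rewrite -eE mulrA mulfK // mulrC.
  by rewrite [c * _]mulrC divfK.
have [Vx|Vx] := VV x x0; [left|right].
  by rewrite xE in Vx *; exact: half.
by rewrite xE invf_div in Vx *; apply: half; rewrite // mulrC.
Qed.

Lemma valuation_treed :
    (forall P, prime_star_ideal star P -> valuation_overring (localize P DK)) ->
  star_treed star.
Proof.
move=> HV P Q1 Q2 HP [pQ1 _] [pQ2 _] Q1P Q2P.
have [pP _] := HP; have [_ VP] := HV P HP.
apply: contrapT => /not_orP[/existsNP[a /not_implyP[Qa1 Qa2]]].
move=> /existsNP[b /not_implyP[Qb2 Qb1]].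
have key Q c d : prime_ideal Q -> Q `<=` P -> Q d -> d != 0 -> DK c -> ~ Q c ->
    ~ localize P DK (c / d).
  move=> pQ QP Qd d0 cD Qc [s [sD Ps] scd].
  have : Q (s * (c / d) * d) by exact: primeM.
  rewrite -mulrA divfK //; apply: prime_notM => //.
  by move=> Qs; apply: Ps; exact: QP.
have a0 := prime_neq0 pQ2 Qa2; have b0 := prime_neq0 pQ1 Qb1.
have aD := prime_dom pQ1 Qa1; have bD := prime_dom pQ2 Qb2.
have [|Rx|] := VP (a / b); first exact: div_neq0.
  exact: (key Q2 a b).
by rewrite invf_div; exact: (key Q1 b a).
Qed.

(** * Comaximal components of a star ideal *)

Section Components.
Hypotheses (hloc : star_h_local star) (PMD : PstarMD star).
Let valuation_max M (mM : maximal_star_ideal star M) :=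
  PstarMD_valuation PMD (maximal_star_ideal_prime mM).

(** If the component lies in N, then no s t with s outside M and t outside N is
    in I, so some prime star ideal over I is contained in both M and N; by
    h-locality M = N. *)
Lemma component_maximal I M N : star_ideal star I ->
    maximal_star_ideal star M -> maximal_star_ideal star N ->
  localize M I `&` DK `<=` N -> M = N.
Proof.
move=> HI mM mN IN.
have [pM _] := maximal_star_ideal_prime mM.
have [pN _] := maximal_star_ideal_prime mN.
pose T := [set y | exists s t, [/\ DK s, ~ M s, DK t, ~ N t & y = s * t]].
have [|||_ [s [t [sD Ms tD Nt ->]]] Ist|P [HP IP PT]] :=
  prime_star_ideal_avoiding_elements (T := T) _ _ _ HI.
- by move=> _ [s [t [sD _ tD _ ->]]]; auto.
- by exists 1, 1; rewrite mulr1; split=> //; exact: prime_not1.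
- move=> _ _ [s [t [sD Ms tD Nt ->]]] [u [v [uD Mu vD Nv ->]]].
  exists (s * u), (t * v); rewrite mulrACA.
  by split; auto; exact: prime_notM.
- by apply: Nt; apply: IN; split=> //; exists s.
have PD := prime_dom (proj1 HP).
have [M0 [_ uniq]] := (proj2 hloc) P HP.
transitivity M0; [symmetry|]; apply: uniq; split=> // p Pp; apply: contrapT => np.
  by apply: (PT p) => //; exists p, 1; rewrite mulr1; split; auto; exact: prime_not1.
by apply: (PT p) => //; exists 1, p; rewrite mul1r; split; auto; exact: prime_not1.
Qed.

Lemma component_nonzero I M : prime_ideal M -> nonzero_ideal I ->
  nonzero_ideal (localize M I `&` DK).
Proof.
move=> pM [[sI ID] [x Ix x0]]; split; last first.
  by exists x => //; split; [exact: sub_localize | exact: ID].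
split=> [|y []//]; have [I0 IA IM] := sI.
split=> [|y z [Iy yD] [Iz zD]|d y dD [Iy yD]].
- by split=> //; exact: sub_localize.
- by split; [exact: localizeD | exact: domD].
- by split; [apply: localizeM => //; exact: localize_dom | exact: domM].
Qed.

Lemma component_valuation I M : prime_ideal M ->
    valuation_overring (localize M DK) -> nonzero_ideal I ->
  valuation_ideal (localize M I `&` DK).
Proof.
move=> pM VM HI; have HA := component_nonzero pM HI.
have sI : submodule I by case: HI => [[]].
split; first by case: HA.
exists (localize M DK) => //; apply/seteqP; split=> x [Ax xD]; split=> //; last first.
  by rewrite -[x]mulr1; apply: mem_ideal_mul; [split|exact: localize_dom].
apply: (@ideal_mul_sub (localize M I `&` DK) (localize M DK) (localize M I)) Ax.
- by apply: sub_localize => //; case: sI.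
- by move=> y z; exact: localizeD.
- by move=> y z [Iy _] Rz; rewrite mulrC; exact: localizeM.
Qed.

(** Membership in I and in the closed product is compared at each maximal star
    ideal M. All components other than the one at M contain elements outside M,
    and the component at M, if there is one, agrees with I there. *)
Lemma star_ideal_comaximal_factorization I : star_ideal star I ->
  star_product_of_comaximal_valuation_ideals star I.
Proof.
move=> HI; have IN := star_ideal_nonzero HI; have [[sI ID] [a Ia a0]] := IN.
have [IE|nI] := pselect (I = DK).
  exists 1%N, (fun=> DK); split=> // [_|_|i j|].
  - exact: nonzero_ideal_dom.
  - split; first by case: nonzero_ideal_dom.
    exists setT; first by split; [split | left].
    apply/seteqP; split=> [x []//|x xD]; split=> //.
    by rewrite -[x]mulr1; exact: mem_ideal_mul.
  - by rewrite !ord1 eqxx.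
  - rewrite /ideal_prod big_ord_recl big_ord0 ideal_mul_dom IE.
    by rewrite (star_dom star_op).
have [ms msE] : exists ms : seq (set K),
    [set` ms] = [set M | maximal_star_ideal star M /\ I `<=` M].
  have [a' _ aE] := ID _ Ia.
  have fin : finite_set [set M | maximal_star_ideal star M /\ I `<=` M].
    apply: (@sub_finite_set _ _ [set M | maximal_star_ideal star M /\ M (tofrac a')]).
      by move=> M [mM IM]; split=> //; rewrite aE; exact: IM.
    apply: (proj1 hloc); first by rewrite -tofrac_eq0 aE.
    apply/negP => ua; apply: nI; apply: (ideal_one IN).
    have [_ _ IM] := sI; rewrite -(mulVf a0) -aE; apply: IM.
      by exists a'^-1 => //; rewrite rmorphV.
    by rewrite aE.
  by have /finite_seqP[ms ->] := fin; exists ms.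
pose us := undup ms.
pose m (i : 'I_(size us)) := nth set0 us i.
have mP i : maximal_star_ideal star (m i) /\ I `<=` m i.
  have : [set` ms] (m i) by rewrite /= -mem_undup mem_nth.
  by rewrite msE.
have minj i j : m i = m j -> i = j.
  by move=> /eqP; rewrite nth_uniq ?undup_uniq // => /eqP/val_inj.
have msur M : maximal_star_ideal star M -> I `<=` M -> exists i, m i = M.
  move=> mM IM; have : [set` ms] M by rewrite msE.
  rewrite /= -mem_undup => /(nthP set0)[k ks kE]; by exists (Ordinal ks).
have pm i := proj1 (maximal_star_ideal_prime (proj1 (mP i))).
pose A i := localize (m i) I `&` DK.
have AN i : nonzero_ideal (A i) by exact: component_nonzero.
have AM i M : maximal_star_ideal star M -> A i `<=` M -> m i = M.
  by move=> mM; apply: component_maximal => //; case: (mP i).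
have HP := nonzero_ideal_prod AN.
exists (size us), A; split=> //.
- have [M [mM _] IM] := exists_maximal_star_ideal HI nI.
  by have [[k ks] _] := msur M mM IM; exact: leq_ltn_trans ks.
- by move=> i; apply: component_valuation => //; apply: valuation_max; case: (mP i).
- move=> i j ij; apply: star_eq_dom => // [|M mM AijM].
    exact: nonzero_ideal_add.
  move/eqP: ij; apply; apply: minj.
  rewrite (AM i M mM) ?(AM j M mM) // => x Ax; apply: AijM.
    exists 0; first by have [[[]]] := AN i.
    by exists x; rewrite ?add0r.
  exists x => //; exists 0; last by rewrite addr0.
  by have [[[]]] := AN j.
apply/seteqP; split.
  move=> x Ix; apply: star_local => //; first exact: ID.
  move=> M mM; have [pM _] := maximal_star_ideal_prime mM.
  (* Multiplying x by elements of the components not inside M puts it in the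
     product of all components; x itself serves for the component at M. *)
  have pick i : exists t, [/\ A i t, DK t & m i <> M -> ~ M t].
    have [mE|nmE] := pselect (m i = M).
      by exists x; split=> //; [split; [exact: sub_localize|exact: ID]|exact: ID].
    apply: contrapT => nt; apply: nmE; apply: AM => // t At.
    by apply: contrapT => Mt; apply: nt; exists t; split=> //; case: At.
  have [t Ht] := choice pick.
  have [[j jE]|none] := pselect (exists j, m j = M).
    exists (\prod_(i < size us | i != j) t i).
      apply: prime_not_prod => // i ij; have [_ tD tM] := Ht i; split=> //.
      by apply: tM; rewrite -jE => /minj ijE; rewrite ijE eqxx in ij.
    pose u i := if i == j then x else t i.
    have := @mem_ideal_prod _ A u; rewrite (bigD1 j) //= {2}/u eqxx mulrC.
    have -> : \prod_(i < size us | i != j) u i = \prod_(i < size us | i != j) t i.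
      by apply: eq_bigr => i /negPf ij; rewrite /u ij.
    apply=> i; rewrite /u; case: eqP => [_|_]; last by case: (Ht i).
    by split; [exact: sub_localize|exact: ID].
  exists (\prod_(i < size us) t i).
    apply: prime_not_prod => // i _; have [_ tD tM] := Ht i; split=> //.
    by apply: tM => mE; apply: none; exists i.
  have [[[_ _ PM] _] _] := HP; rewrite mulrC; apply: PM; first exact: ID.
  by apply: mem_ideal_prod => i; case: (Ht i).
apply: star_min => // y Py; have [_ _ <-] := HI.
have yD : DK y by have [[_ PD] _] := HP; exact: PD.
apply: star_local => // M mM.
have [pM _] := maximal_star_ideal_prime mM.
have [IM|/existsNP[t /not_implyP[It Mt]]] := pselect (I `<=` M).
  have [j <-] := msur M mM IM.
  by have [] : A j y by exact: ideal_prod_factor Py.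
exists t; first by split=> //; exact: ID.
by rewrite mulrC; case: sI => _ _; apply.
Qed.

End Components.

End Star.
End Ideals.

Theorem theorem3p15 (D : idomainType)
    (star : set {fraction D} -> set {fraction D})
    (star_op : star_operation star) (star_ft : finite_type star) :
  [<-> star_h_local star /\ PstarMD star;
       forall I : set {fraction D}, star_ideal star I ->
         star_product_of_comaximal_valuation_ideals star I;
       forall I : set {fraction D}, star_ideal star I -> star_finite star I ->
         star_product_of_comaximal_valuation_ideals star I;
       forall a : D, a != 0 ->
         star_product_of_comaximal_valuation_ideals star
           (principal (tofrac a));
       star_treed star /\ star_VIFD star;
       star_treed star /\
         (forall P : set {fraction D}, prime_ideal P ->
            (exists2 x, P x & x != 0) ->
            exists I : set {fraction D},
              [/\ valuation_ideal I, star_invertible star I & I `<=` P]);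
       star_treed star /\
         (forall I : set {fraction D}, star_ideal star I ->
            star_product_of_valuation_ideals star I)].
Proof.
have forget I : star_product_of_comaximal_valuation_ideals star I ->
    star_product_of_valuation_ideals star I.
  by move=> [n [J [n0 HJ vJ _ JE]]]; exists n, J.
have principalD (a : D) : a != 0 ->
    nonzero_ideal (principal (tofrac a)) /\ star_ideal star (principal (tofrac a)).
  rewrite -tofrac_eq0 => a0; have aD : dom D (tofrac a) by exists a.
  by split; [exact: nonzero_ideal_principal | exact: star_ideal_principal].
have VIFD_prime : star_VIFD star -> forall P : set {fraction D}, prime_ideal P ->
    (exists2 x, P x & x != 0) -> exists I : set {fraction D},
      [/\ valuation_ideal I, star_invertible star I & I `<=` P].
  move=> HV P pP [_ /[dup] /(prime_dom pP)[a _ <-] Pa]; rewrite tofrac_eq0 => a0.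
  have [n [I [_ HI vI aE]]] := HV a a0.
  have HP := nonzero_ideal_prod HI.
  apply: contrapT => nI.
  have pick i : exists t, I i t /\ ~ P t.
    apply: contrapT => nt; apply: nI; exists (I i); split=> //.
      by apply: star_product_factor_invertible aE; rewrite // tofrac_eq0.
    by move=> t It; apply: contrapT => Pt; apply: nt; exists t.
  have [t Ht] := choice pick.
  have [_] : dom D (\prod_(i < n) t i) /\ ~ P (\prod_(i < n) t i).
    apply: prime_not_prod => // i _; have [It Pt] := Ht i.
    by split=> //; have [[_ ID] _] := HI i; exact: ID.
  apply; apply: (principal_sub _ Pa); first by case: pP => [[]].
  rewrite aE; apply: (sub_star star_op HP); apply: mem_ideal_prod => i.
  by case: (Ht i).
have back : star_treed star /\
     (forall P : set {fraction D}, prime_ideal P -> (exists2 x, P x & x != 0) ->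
        exists I : set {fraction D},
          [/\ valuation_ideal I, star_invertible star I & I `<=` P]) ->
    star_h_local star /\ PstarMD star.
  move=> [treed HI].
  have HI' P : prime_star_ideal star P -> exists I : set {fraction D},
      [/\ valuation_ideal I, star_invertible star I & I `<=` P].
    move=> [pP sP]; apply: HI => //; by have [] := star_ideal_nonzero sP.
  have VM M : maximal_star_ideal star M -> valuation_overring (localize M (dom D)).
    move=> mM; apply: (valuation_localize star_op star_ft treed HI').
    exact: maximal_star_ideal_prime.
  split; first exact: (h_local_of_prime_contains star_op star_ft VM HI').
  exact: (valuation_PstarMD star_op star_ft VM).
tfae.
- by move=> [hloc PMD] I; exact: (star_ideal_comaximal_factorization star_op star_ft).
- by move=> H I HI _; exact: H.
- move=> H a a0; have [aN aS] := principalD a a0; apply: (H) => //.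
  exists (principal (tofrac a)); last by case: aS.
  split; first exact: nonzero_ideal_fractional.
  by exists 1%N, (fun=> tofrac a); exact: principal_generated.
- move=> H; split; last by move=> a a0; exact/forget/H.
  apply: valuation_treed => P HP; exact: (comaximal_factorization_valuation star_op).
- by move=> [treed HV]; split=> //; exact: VIFD_prime.
- move=> H; split; first by case: H.
  have [hloc PMD] := back H.
  by move=> I HI; apply: forget;
     exact: (star_ideal_comaximal_factorization star_op star_ft).
- move=> [treed H]; apply: back; split=> //; apply: VIFD_prime => a a0.
  by apply: H; case: (principalD a a0).
Qed.
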